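(* Let $\mathcal{A}:\mathbb{S}^n\to\mathbb{R}^m$ be linear, $b\in\mathbb{R}^m$, $C\in\mathbb{S}^n$, and let $X^*$ be an optimal solution of the linear SDP $$\min_{X\in\mathbb{S}^n}\{\langle C,X\rangle:\ \mathcal{A}X=b,\ X\in\mathbb{S}^n_+\}.$$ Suppose that the multifunction $\mathcal{G}(X)=(\mathcal{A}X-b,\,X)-\{0\}^m\times\mathbb{S}^n_+$, $X\in\mathbb{S}^n$, is metrically regular at $(X^*,(0,0))$. Pick any $(y^*,S^* )\in\mathcal{M}(X^*,-C)$ and let $\alpha^*,\beta^*,\gamma^*$, $\alpha_1,\dots,\alpha_p$ be the index sets associated with $(X,S)=(X^*,S^* )$. Then: (i) If $(y^*,S^* )\in\arg\min_{(y,S)\in\mathcal{M}(X^*,-C)}\operatorname{rank}(S)$ and $\operatorname{Ker}\mathcal{A}\cap[\![C]\!]^\perp\cap\Upsilon^*=\{0\}$, then $X^*$ is tilt-stable. If $\mathrm{Sp}(\mathcal{N}_{\mathbb{S}^n_+}(X^* ))\cap\mathrm{Im}\,\mathcal{A}^*=\{0\}$ or $\mathrm{Sp}(\mathcal{N}_{\mathbb{S}^n_+}(X^* ))\subset\mathcal{A}^*\mathbb{R}^m$, then the tilt stability of $X^*$ implies $\operatorname{Ker}\mathcal{A}\cap\widetilde\Upsilon^*=\{0\}$. (ii) If $\mathcal{M}(X^*,-C)=(\mathcal{A}^* )^{-1}(-C-S^* )\times\{S^*\}$ and $\operatorname{Ker}\mathcal{A}\cap\widehat\Upsilon^*=\{0\}$,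 then $X^*$ is tilt-stable. If $\mathrm{Sp}(\mathcal{N}_{\mathbb{S}^n_+}(X^* ))\cap\mathrm{Im}\,\mathcal{A}^*=\{0\}$ or $\mathrm{Sp}(\mathcal{N}_{\mathbb{S}^n_+}(X^* ))\subset\mathcal{A}^*\mathbb{R}^m$, then the tilt stability of $X^*$ implies $\operatorname{Ker}\mathcal{A}\cap\widehat\Upsilon^*=\{0\}$. Here - $\Upsilon^*$ is the set of $W\in\mathbb{S}^n$ for which there exist $P^*\in\mathbb{O}(X^* )\cap\mathbb{O}(S^* )$ and $Q=\mathrm{BlkDiag}(Q_1,\ldots,Q_p)$ with $Q_j\in\mathbb{O}^{|\alpha_j|}$ such that $R:=P^*Q\in\mathbb{O}(X^* )$ and $[R_{\alpha^*}\ R_{\beta^*}\ R_{\gamma^*}]^\top WR_{\gamma^*}=0$; - $\widetilde\Upsilon^*$ is the set of $W\in\mathbb{S}^n$ for which there exists $P^*\in\mathbb{O}(X^* )\cap\mathbb{O}(S^* )$ with $[P^*_{\alpha^*}\ P^*_{\beta^*}\ P^*_{\gamma^*}]^\top WP^*_{\gamma^*}=0$; - $\widehat\Upsilon^*$ is the set of $W\in\mathbb{S}^n$ for which there exists $R\in\mathbb{O}(X^* )\cap\mathbb{O}(S^* )$ with $[R_{\alpha^*}\ R_{\beta^*}\ R_{\gamma^*}]^\top WR_{\gamma^*}=0$.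
   Context: $\mathbb{S}^n$ is the space of real symmetric $n\times n$ matrices with the trace inner product $\langle\cdot,\cdot\rangle$ and Frobenius norm; $\mathbb{S}^n_+$ is the cone of positive semidefinite matrices; $\mathbb{O}^k$ is the set of $k\times k$ real orthogonal matrices; $[n]=\{1,\ldots,n\}$; $\mathbb{B}(x,\delta)$ is the closed ball; $[\![C]\!]^\perp$ is the orthogonal complement of the span of $C$; $\mathcal{A}^*$ is the adjoint of $\mathcal{A}$ and $(\mathcal{A}^* )^{-1}(U)=\{y:\mathcal{A}^*y=U\}$. $\Gamma:=\{X\in\mathbb{S}^n_+:\mathcal{A}X=b\}$. Tilt stability: for $f$ proper extended-real-valued on a Euclidean space, $\bar x\in\mathrm{dom}\,f$ is a tilt-stable local minimum of $f$ if there is $\delta>0$ such that $M_\delta(v):=\arg\min_{x\in\mathbb{B}(\bar x,\delta)}\{f(x)-f(\bar x)-\langle v,x-\bar x\rangle\}$ is single-valued and Lipschitz continuous on some neighborhood of $v=0$ with $M_\delta(0)=\{\bar x\}$. ''$X^*$ is tilt-stable'' means that $X^*$ is a tilt-stable local minimum of $X\mapsto\langle C,X\rangle+\delta_\Gamma(X)$, $\delta_\Gamma$ the indicator function of $\Gamma$. Metric regularity: a multifunction $\mathcal{F}$ is metrically regular at $(x,z)\in\mathrm{gph}\,\mathcal{F}$ if there are $\delta,\kappa>0$ with $\mathrm{dist}(x',\mathcal{F}^{-1}(z'))\le\kappa\,\mathrm{dist}(z',\mathcal{F}(x'))$ for all $(x',z')\in\mathbb{B}((x,z),\delta)$. Normal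 cones are those of convex analysis: $\mathcal{N}_\Omega(x)=\{v:\langle v,x'-x\rangle\le0\ \forall x'\in\Omega\}$. For a closed convex cone $K$, $\mathrm{Sp}(K):=\mathbb{R}_+(K-K)$ is the linear space generated by $K$. Multipliers: $\mathcal{M}(X,V):=\{(y,S)\in\mathbb{R}^m\times\mathcal{N}_{\mathbb{S}^n_+}(X):\mathcal{A}^*y+S=V\}$ if $V\in\mathcal{N}_\Gamma(X)$, and $\emptyset$ otherwise. Spectral notation: $\lambda_1(X)\ge\cdots\ge\lambda_n(X)$ are the eigenvalues of $X\in\mathbb{S}^n$, $\lambda(X)=(\lambda_1(X),\ldots,\lambda_n(X))^\top$, $\mathbb{O}(X):=\{P\in\mathbb{O}^n: X=P\,\mathrm{Diag}(\lambda(X))P^\top\}$. For $X\in\mathbb{S}^n_+$, $S\in\mathcal{N}_{\mathbb{S}^n_+}(X)$, the distinct eigenvalues of $X$ are denoted $\mu_1>\cdots>\mu_p=0$ (the class for $\mu_p=0$ being empty if $X$ is nonsingular), and $\alpha_j:=\{i\in[n]:\lambda_i(X)=\mu_j\}$; $\alpha:=\{i:\lambda_i(X)>0\}$, $\beta:=\{i:\lambda_i(X)=0=\lambda_i(S)\}$, $\gamma:=\{i:\lambda_i(S)<0\}$; $\alpha^*,\beta^*,\gamma^*$ are these sets for $(X^*,S^* )$. $M_J$ is the submatrix of the columns of $M$ indexed by $J$. *)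

(* Defs.v *)
From HB Require Import structures.
From mathcomp Require Import all_boot all_order all_algebra sesquilinear.
From mathcomp Require Import polyrcf.
From mathcomp Require Import mathcomp_extra boolp classical_sets reals ereal.

Set Implicit Arguments.
Unset Strict Implicit.
Unset Printing Implicit Defensive.

Import Order.TTheory GRing.Theory Num.Theory.
Local Open Scope classical_set_scope.
Local Open Scope ring_scope.

(* Variational analysis on a Euclidean space, given as a module [E] together
   with its inner product [ip].  The topology of [E], if any, is not used: the
   norm is always the one induced by [ip]. *)
Section Euclidean.
Context {R : realType} {E : lmodType R} (ip : E -> E -> R).

Definition enorm (x : E) : R := Num.sqrt (ip x x).

Definition cball (x : E) (r : R) : set E := [set x' | enorm (x' - x) <= r].

(* [+oo] when [D] is empty *)
Definition dist (x : E) (D : set E) : \bar R :=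
  ereal_inf [set (enorm (x - d))%:E | d in D].

Definition orth (L : set E) : set E := [set w | forall u, L u -> ip u w = 0].

Definition normal_cone (Omega : set E) (x : E) : set E :=
  [set v | forall x', Omega x' -> ip v (x' - x) <= 0].

Definition set_indicator (Omega : set E) (x : E) : \bar R :=
  if `[< Omega x >] then 0%E else +oo%E.

Definition argmin (D : set E) (g : E -> \bar R) : set E :=
  [set x | D x /\ forall x', D x' -> (g x <= g x')%E].

Definition proper_function (f : E -> \bar R) : Prop :=
  (forall x, f x <> -oo%E) /\ (exists x, f x <> +oo%E).

(* M_delta(v) *)
Definition tilt_argmin (f : E -> \bar R) (xbar : E) (delta : R) (v : E) :
    set E :=
  argmin (cball xbar delta)
    (fun x => (f x - f xbar - (ip v (x - xbar))%:E)%E).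

Definition single_valued_lipschitz_on (D : set E) (M : E -> set E) : Prop :=
  (forall v, D v -> exists x, M v = [set x]) /\
  (exists L : R, forall v v' x x', D v -> D v' -> M v x -> M v' x' ->
     enorm (x - x') <= L * enorm (v - v')).

Definition tilt_stable_local_min (f : E -> \bar R) (xbar : E) : Prop :=
  [/\ proper_function f, f xbar <> +oo%E &
    exists2 delta : R, 0 < delta &
      (exists2 eps : R, 0 < eps &
        single_valued_lipschitz_on (cball 0 eps) (tilt_argmin f xbar delta))
      /\ tilt_argmin f xbar delta 0 = [set xbar]].

(* Sp(K) = R_+ (K - K) *)
Definition Sp (K : set E) : set E :=
  [set w | exists t u v, [/\ 0 <= t, K u, K v & w = t *: (u - v)]].

Definition lspan1 (c : E) : set E := [set t *: c | t in [set: R]].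

End Euclidean.

Definition prod_ip {R : realType} {E F : lmodType R}
    (ipE : E -> E -> R) (ipF : F -> F -> R) (p q : E * F) : R :=
  ipE p.1 q.1 + ipF p.2 q.2.

Definition metrically_regular {R : realType} {E F : lmodType R}
    (ipE : E -> E -> R) (ipF : F -> F -> R)
    (G : E -> set F) (x : E) (z : F) : Prop :=
  G x z /\
  exists delta kappa : R, [/\ 0 < delta, 0 < kappa &
    forall (x' : E) (z' : F),
      cball (prod_ip ipE ipF) (x, z) delta (x', z') ->
      (dist ipE x' [set u | G u z'] <= kappa%:E * dist ipF z' (G x'))%E].

(* The space S^n as a type. *)
Section SymMatrix.
Context (R : realType) (n : nat).

Definition symmx : {pred 'M[R]_n} := [pred M | M \is symmetricmx].

Fact symmxE (M : 'M[R]_n) : (M \in symmx) = (M^T == M).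
Proof.
by rewrite [LHS]is_hermitianmxE expr0 scale1r map_mx_id // eq_sym.
Qed.

Fact symmx_submod_closed : submod_closed symmx.
Proof.
split=> [|a u v]; rewrite !symmxE; first by rewrite trmx0.
by move=> /eqP hu /eqP hv; rewrite linearD linearZ /= hu hv.
Qed.

HB.instance Definition _ :=
  GRing.isSubmodClosed.Build R 'M[R]_n symmx symmx_submod_closed.

Record symM := SymM { symM_val :> 'M[R]_n; _ : symM_val \in symmx }.

HB.instance Definition _ := [isSub for symM_val].
HB.instance Definition _ := [Choice of symM by <:].
HB.instance Definition _ := [SubChoice_isSubLmodule of symM by <:].

Fact sympart_sym (M : 'M[R]_n) : 2^-1 *: (M + M^T) \in symmx.
Proof. by rewrite symmxE linearZ linearD /= trmxK addrC. Qed.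

Definition sympart (M : 'M[R]_n) : symM := SymM (sympart_sym M).

End SymMatrix.
Arguments symmx : clear implicits.

(* On column vectors this is the usual dot product. *)
Definition mxip {R : realType} {p q : nat} (M N : 'M[R]_(p, q)) : R :=
  \tr (M^T *m N).

Lemma mxipE {R : realType} {p q : nat} (M N : 'M[R]_(p, q)) :
  mxip M N = \sum_i \sum_j M i j * N i j.
Proof.
rewrite exchange_big; apply: eq_bigr => j _; rewrite mxE.
by apply: eq_bigr => i _; rewrite mxE.
Qed.

Definition symip {R : realType} {n : nat} (X Y : symM R n) : R := mxip X Y.

Definition psd {R : realType} {n : nat} : set (symM R n) :=
  [set X | forall u : 'cV[R]_n, 0 <= (u^T *m X *m u) 0 0].

Section Adjoint.
Context {R : realType} {n m : nat} (A : {linear symM R n -> 'cV[R]_m}).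

(* the entries of A^* y are its inner products with the matrices
   (E_ij + E_ji) / 2 *)
Definition adj_mx (y : 'cV[R]_m) : 'M[R]_n :=
  \matrix_(i, j) mxip y (A (sympart (delta_mx i j))).

Fact adj_mx_sym (y : 'cV[R]_m) : adj_mx y \in symmx R n.
Proof.
rewrite symmxE; apply/eqP/matrixP => i j; rewrite !mxE; congr (mxip y (A _)).
by apply: val_inj => /=; rewrite !trmx_delta addrC.
Qed.

Definition adjoint (y : 'cV[R]_m) : symM R n := SymM (adj_mx_sym y).

Lemma adjointP (y : 'cV[R]_m) (X : symM R n) :
  symip (adjoint y) X = mxip y (A X).
Proof.
have XE : X = \sum_i \sum_j (X : 'M[R]_n) i j *: sympart (delta_mx i j).
  apply: val_inj; rewrite raddf_sum /=.
  have XT : (val X)^T = val X by apply/eqP; rewrite -symmxE; case: X.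
  transitivity (2^-1 *: (val X + (val X)^T)).
    by rewrite XT -mulr2n -scaler_nat scalerA mulVf ?scale1r ?pnatr_eq0.
  have -> : val X + (val X)^T =
      \sum_i \sum_j val X i j *: (delta_mx i j + (delta_mx i j)^T).
    under eq_bigr do under eq_bigr do rewrite scalerDr -linearZ /=.
    under eq_bigr do rewrite big_split -raddf_sum /=.
    by rewrite big_split -raddf_sum /= -matrix_sum_delta.
  rewrite scaler_sumr; apply: eq_bigr => i _.
  rewrite scaler_sumr -[RHS]/(val _) [RHS]raddf_sum; apply: eq_bigr => j _.
  by rewrite /= !scalerA mulrC.
rewrite {2}XE linear_sum /mxip mulmx_sumr raddf_sum.
rewrite /symip mxipE; apply: eq_bigr => i _.
rewrite linear_sum mulmx_sumr raddf_sum; apply: eq_bigr => j _ /=.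
by rewrite linearZ /= -scalemxAr mxtraceZ mulrC mxE.
Qed.

End Adjoint.

Section Spectral.
Context {R : realType} {n : nat}.

(* the real eigenvalues, repeated according to multiplicity, nonincreasing;
   for a symmetric matrix there are n of them *)
Definition eigs (M : 'M[R]_n) : seq R :=
  sort (fun x y => y <= x)
    (flatten [seq nseq (mup x (char_poly M)) x | x <- rootsR (char_poly M)]).

Definition lambda (M : 'M[R]_n) : 'rV[R]_n := \row_i nth 0 (eigs M) i.

Definition orthogonal_group {k : nat} : set 'M[R]_k :=
  [set P | P^T *m P = 1%:M].

(* the set O(X) *)
Definition eigenframes (X : symM R n) : set 'M[R]_n :=
  [set P | orthogonal_group P /\
           (X : 'M[R]_n) = P *m diag_mx (lambda X) *m P^T].

(* the sequence mu_1 > ... > mu_p = 0 attached to a positive semidefinite X *)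
Definition distinct_eigs (X : symM R n) : seq R :=
  rcons (undup [seq x <- eigs X | 0 < x]) 0.

Definition alpha_class (X : symM R n) (j : 'I_(size (distinct_eigs X))) :
    {set 'I_n} :=
  [set i | lambda X 0 i == nth 0 (distinct_eigs X) j].

Definition idx_alpha (X : symM R n) : {set 'I_n} := [set i | 0 < lambda X 0 i].
Definition idx_beta (X S : symM R n) : {set 'I_n} :=
  [set i | (lambda X 0 i == 0) && (lambda S 0 i == 0)].
Definition idx_gamma (S : symM R n) : {set 'I_n} := [set i | lambda S 0 i < 0].

(* the submatrix M_J of the columns of M indexed by J, in increasing order *)
Definition subcols {k : nat} (J : {set 'I_n}) (M : 'M[R]_(k, n)) :
    'M[R]_(k, #|J|) :=
  colsub (fun i : 'I_#|J| => enum_val i) M.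

(* The block Q_j occupies the rows and the columns in alpha_j; as lambda X is
   sorted, alpha_1, ..., alpha_p are consecutive intervals, so that this is
   BlkDiag(Q_1, ..., Q_p). *)
Definition blkdiag (X : symM R n)
    (Q : forall j : 'I_(size (distinct_eigs X)), 'M[R]_#|alpha_class j|) :
    'M[R]_n :=
  \sum_j subcols (alpha_class j) 1%:M *m Q j *m (subcols (alpha_class j) 1%:M)^T.

(* [P_alpha P_beta P_gamma]^T W P_gamma = 0 *)
Definition gamma_columns_vanish (X S : symM R n) (P : 'M[R]_n)
    (W : symM R n) : Prop :=
  (row_mx (row_mx (subcols (idx_alpha X) P) (subcols (idx_beta X S) P))
          (subcols (idx_gamma S) P))^T
    *m W *m subcols (idx_gamma S) P = 0.

Definition Upsilon (X S : symM R n) : set (symM R n) :=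
  [set W | exists (P : 'M[R]_n)
     (Q : forall j : 'I_(size (distinct_eigs X)), 'M[R]_#|alpha_class j|),
     [/\ (eigenframes X `&` eigenframes S) P,
         forall j, orthogonal_group (Q j),
         eigenframes X (P *m blkdiag Q) &
         gamma_columns_vanish X S (P *m blkdiag Q) W]].

Definition Upsilon_tilde (X S : symM R n) : set (symM R n) :=
  [set W | exists P : 'M[R]_n,
     (eigenframes X `&` eigenframes S) P /\ gamma_columns_vanish X S P W].

(* Spelled out as in the source, this is the same set as [Upsilon_tilde]. *)
Definition Upsilon_hat (X S : symM R n) : set (symM R n) :=
  [set W | exists P : 'M[R]_n,
     (eigenframes X `&` eigenframes S) P /\ gamma_columns_vanish X S P W].

End Spectral.

Section SDP.
Context {R : realType} {n m : nat}.
Variables (A : {linear symM R n -> 'cV[R]_m}) (b : 'cV[R]_m).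
Implicit Types (C X V S : symM R n) (y : 'cV[R]_m).

Definition feasible : set (symM R n) := [set X | psd X /\ A X = b].

Definition sdp_optimal C X : Prop :=
  feasible X /\ forall X', feasible X' -> symip C X <= symip C X'.

Definition sdp_tilt_stable C X : Prop :=
  tilt_stable_local_min symip
    (fun X' => (symip C X')%:E + set_indicator feasible X')%E X.

Definition constraint_map X : set ('cV[R]_m * symM R n) :=
  [set (A X - b, X) - k | k in [set 0] `*` psd].

Definition multipliers X V : set ('cV[R]_m * symM R n) :=
  [set yS | [/\ normal_cone symip feasible X V,
                normal_cone symip psd X yS.2 &
                adjoint A yS.1 + yS.2 = V]].

Definition linker : set (symM R n) := [set W | A W = 0].

End SDP.

(* Main.v *)
Require Import Defs.
From HB Require Import structures.
From mathcomp Require Import all_boot all_order all_algebra.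
From mathcomp Require Import polyrcf.
From mathcomp Require Import boolp classical_sets set_interval reals ereal.
From mathcomp Require Import ring lra.
From mathcomp Require Import filter topology normedtype sequences.

Set Implicit Arguments.
Unset Strict Implicit.
Unset Printing Implicit Defensive.

Import Order.TTheory GRing.Theory Num.Theory.
Import numFieldNormedType.Exports.
Local Open Scope classical_set_scope.
Local Open Scope ring_scope.

(** Write [Gamma] for the feasible set, [f] for the linear objective plus the
indicator of [Gamma], and call [S] a multiplier when
[adjoint A y + S = - C] with [S] normal to the psd cone at [Xs], that is [S]
negative semidefinite with [Xs S = 0].

What the three sets mean.  A matrix [R] in [O(Xs)] is an orthonormal eigenbasis
whose columns indexed by alpha, beta, gamma are all of its columns, so the
vanishing condition says [W R_gamma = 0].  For [R] in [O(Xs)] and [O(Ss)], the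
columns [R_gamma] span the range of [Ss], hence [Upsilon_tilde], which is also
[Upsilon_hat], is the set of [W] with [W Ss = 0] ([Upsilon_tildeP]).  For
[Upsilon] only [R] in [O(Xs)] is required, so [W] has to vanish on some space of
dimension [rank Ss] inside the kernel of [Xs]; this happens as soon as
[W S = 0] for a multiplier [S] of rank at least [rank Ss] ([Upsilon_of_rank]).

Sufficiency.  As [f] is convex, tilt stability follows from a growth
[kappa |Y - X|^2 <= <C - V, Y - X>], uniform over small tilts [V], tilted
minimizers [X] and feasible [Y] near [Xs] ([tilt_stable_of_growth]).  Suppose
that the growth fails along [V_k -> 0] and [X_k, Y_k -> Xs].  Metric regularity
yields a Slater point, so that the minimizers [X_k] have multipliers [S_k]
([multiplier_exists]), bounded ones ([normal_cone_bound]).  Put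
[W_k = (Y_k - X_k) / |Y_k - X_k|] and pass to limits [W] and [S].  Since
[S_k X_k = 0], the failing growth bounds [- <S_k, Y_k>] by
[o(|Y_k - X_k|^2)], and [|Y S|^2 <= tr Y tr(-S) (- <S, Y>)] for psd [Y] and
[- S] ([psdmx_mulmx_bound]) gives [W_k S_k -> 0].  So [W] is a unit vector of
the kernel of [A] with [W S = 0], hence [<C, W> = 0], where [S] is a multiplier
of the unperturbed problem ([growth_of_sharp_multipliers]).  In part (i) the
rank condition puts [W] in [Upsilon], in part (ii) [S = Ss] puts it in
[Upsilon_hat]; both contradict the hypothesis.

Necessity.  With a Slater point the second qualification forces the normal cone
to be trivial, so it implies the first one ([normal_cone_trivial]), under which
a matrix in the kernel of [A] can be found with any prescribed compression to
the kernel of [Xs] ([nondegenerate_surjection]).  Let [A W = 0] and [W Ss = 0].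
Using prescribed compressions, one builds feasible arcs
[Xs + e D + e^2 B] and [Xs + e (D + t W) + e^2 B] ([perturbation_psd]) that are
both complementary, up to [eta e^2 tr(- Ss) + O(e^3)] with [eta] as small as
desired, to one and the same [S_e] near [Ss] ([perturbation_gap]).  Tilt
stability bounds the squared distance [e^2 t^2 |W|^2] of the two points by a
constant times the two complementarity gaps ([tilt_stable_gap]), so [W = 0].

Compactness enters through limits along a free ultrafilter on [nat], taken
entrywise: every bounded sequence has a limit, and no subsequences have to be
extracted. *)

(** * Limits along a free ultrafilter *)

Fact free_ultrafilter_exists :
  exists U : set_system nat, UltraFilter U /\ \oo `<=` U.
Proof.
have [U [UU sU]] := ultraFilterLemma (_ : ProperFilter \oo).
by exists U.
Qed.

Definition omega : set_system nat := sval (cid free_ultrafilter_exists).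

#[local] Instance omega_ultra : UltraFilter omega.
Proof. by have [] := svalP (cid free_ultrafilter_exists). Qed.

Lemma oo_omega : \oo `<=` omega.
Proof. by have [] := svalP (cid free_ultrafilter_exists). Qed.

#[local] Instance ultra_fmap (T : Type) (f : nat -> T) : UltraFilter (f @ omega).
Proof.
split; first exact: fmap_proper_filter.
move=> G PG sG; apply/seteqP; split=> // A GA.
have [//|nA] := in_ultra_setVsetC (f @^-1` A) omega_ultra.
have : G (A `&` ~` A) by apply: filterI => //; exact: sG.
by rewrite setICr => /filter_not_empty.
Qed.

Section UltraLimits.
Context {R : realType}.
Implicit Types (u v : nat -> R) (l : R).

Lemma ulim_exists u (c : R) :
  (forall k, `|u k| <= c) -> exists l, u @ omega --> l.
Proof.
move=> uc.
have := @segment_compact R (- c) c; rewrite compact_ultra => cpt.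
have uF : (u @ omega) `[- c, c]%classic.
  apply: (@filterE _ omega _ (u @^-1` `[- c, c]%classic)) => k.
  by rewrite /= in_itv /= -ler_norml.
by have [l [_ ul]] := cpt _ (ultra_fmap u) uF; exists l.
Qed.

Lemma ulim_unique u l l' : u @ omega --> l -> u @ omega --> l' -> l = l'.
Proof. by move=> ul ul'; apply: (cvg_unique _ ul ul'). Qed.

Lemma ulim_le u v l l' : u @ omega --> l -> v @ omega --> l' ->
  (forall k, u k <= v k) -> l <= l'.
Proof.
by move=> ul vl uv; apply: (ler_cvg_to ul vl); apply: filterE.
Qed.

Lemma ulimD u v l l' : u @ omega --> l -> v @ omega --> l' ->
  (fun k => u k + v k) @ omega --> (l + l' : R).
Proof. exact: cvgD. Qed.

Lemma ulimB u v l l' : u @ omega --> l -> v @ omega --> l' ->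
  (fun k => u k - v k) @ omega --> (l - l' : R).
Proof. exact: cvgB. Qed.

Lemma ulimM u v l l' : u @ omega --> l -> v @ omega --> l' ->
  (fun k => u k * v k) @ omega --> (l * l' : R).
Proof. exact: cvgM. Qed.

Lemma ulim_const u l : (forall k, u k = l) -> u @ omega --> l.
Proof. by move=> /funext ->; exact: cvg_cst. Qed.

Lemma ulim_le_const u l (c : R) : u @ omega --> l -> (forall k, u k <= c) -> l <= c.
Proof. by move=> ul uc; apply: (@ulim_le u (fun=> c)) ul _ uc; exact: ulim_const. Qed.

Lemma ulim_harmonic : (fun k => k.+1%:R^-1 : R) @ omega --> (0 : R).
Proof.
apply: cvg_trans (@cvg_harmonic R).
by apply: cvg_app => A /oo_omega.
Qed.

Lemma ulim0 u (c : R) : (forall k, `|u k| <= c * k.+1%:R^-1) -> u @ omega --> (0 : R).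
Proof.
move=> uc; have [|l ul] := @ulim_exists u `|c|.
  move=> k; apply: le_trans (uc k) _.
  have c0 : 0 <= c.
    by have := le_trans (normr_ge0 _) (uc 0%N); rewrite invr1 mulr1.
  by rewrite ger0_norm // ler_piMr // invf_le1 ?ler1n ?ltr0n.
have h0 : (fun k => c * k.+1%:R^-1) @ omega --> (c * 0 : R).
  by apply: cvgM; [exact: cvg_cst|exact: ulim_harmonic].
have nl : (fun k => `|u k|) @ omega --> `|l| by exact: cvg_norm.
have := ulim_le nl h0 uc; rewrite mulr0 normr_le0 => /eqP l0.
by rewrite l0 in ul.
Qed.

(** Convergence of entries: it makes the matrix spaces, including the square ones
of size 0, need no topology of their own. *)
Definition mcvg {p q} (M : nat -> 'M[R]_(p, q)) (L : 'M[R]_(p, q)) :=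
  forall i j, (fun k => M k i j) @ omega --> L i j.

Section Mcvg.
Variables p q : nat.
Implicit Types (M N : nat -> 'M[R]_(p, q)) (L K : 'M[R]_(p, q)).

Lemma mcvg_cst L : mcvg (fun=> L) L.
Proof. by move=> i j; exact: cvg_cst. Qed.

Lemma mcvgD M N L K : mcvg M L -> mcvg N K -> mcvg (fun k => M k + N k) (L + K).
Proof.
move=> ML NK i j; rewrite mxE; under eq_fun do rewrite mxE.
by apply: cvgD; [exact: ML|exact: NK].
Qed.

Lemma mcvgN M L : mcvg M L -> mcvg (fun k => - M k) (- L).
Proof.
move=> ML i j; rewrite mxE; under eq_fun do rewrite mxE.
by apply: cvgN; exact: ML.
Qed.

Lemma mcvgB M N L K : mcvg M L -> mcvg N K -> mcvg (fun k => M k - N k) (L - K).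
Proof. by move=> ML NK; apply: mcvgD => //; exact: mcvgN. Qed.

Lemma mcvg_tr M L : mcvg M L -> mcvg (fun k => (M k)^T) L^T.
Proof. by move=> ML i j; rewrite mxE; under eq_fun do rewrite mxE; exact: ML. Qed.

Lemma mcvg_unique M L K : mcvg M L -> mcvg M K -> L = K.
Proof. by move=> ML MK; apply/matrixP => i j; apply: ulim_unique (ML i j) (MK i j). Qed.

End Mcvg.

Lemma ulim_sum (I : Type) (r : seq I) (f : I -> nat -> R) (l : I -> R) :
  (forall i, f i @ omega --> l i) ->
  (fun k => \sum_(i <- r) f i k) @ omega --> \sum_(i <- r) l i.
Proof.
move=> fl; elim: r => [|a r IH].
  by rewrite big_nil; under eq_fun do rewrite big_nil; exact: cvg_cst.
by rewrite big_cons; under eq_fun do rewrite big_cons; exact: cvgD.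
Qed.

Lemma mcvgM p q r (M : nat -> 'M[R]_(p, q)) (N : nat -> 'M[R]_(q, r)) L K :
  mcvg M L -> mcvg N K -> mcvg (fun k => M k *m N k) (L *m K).
Proof.
move=> ML NK i j; rewrite mxE; under eq_fun do rewrite mxE.
by apply: ulim_sum => t; apply: cvgM; [exact: ML|exact: NK].
Qed.

Lemma ulim_mxtrace p (M : nat -> 'M[R]_p) L :
  mcvg M L -> (fun k => \tr (M k)) @ omega --> \tr L.
Proof. by move=> ML; apply: ulim_sum => i; exact: ML. Qed.

Lemma ulim_mxip p q (M N : nat -> 'M[R]_(p, q)) L K :
  mcvg M L -> mcvg N K -> (fun k => mxip (M k) (N k)) @ omega --> mxip L K.
Proof. by move=> ML NK; apply: ulim_mxtrace; apply: mcvgM => //; exact: mcvg_tr. Qed.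

Lemma sqr_entry_le_mxip p q (M : 'M[R]_(p, q)) i j : M i j ^+ 2 <= mxip M M.
Proof.
rewrite mxipE (bigD1 i) //= (bigD1 j) //= -expr2 -addrA lerDl.
apply: addr_ge0; first by apply: sumr_ge0 => t _; rewrite -expr2 sqr_ge0.
by apply: sumr_ge0 => s _; apply: sumr_ge0 => t _; rewrite -expr2 sqr_ge0.
Qed.

Lemma mcvg_exists p q (M : nat -> 'M[R]_(p, q)) (c : R) :
  (forall k, mxip (M k) (M k) <= c) -> exists L, mcvg M L.
Proof.
move=> Mc.
have /choice [L HL] : forall ij : 'I_p * 'I_q,
    exists l, (fun k => M k ij.1 ij.2) @ omega --> l.
  move=> [i j]; apply: (@ulim_exists _ (c + 1)) => k /=.
  have := le_trans (sqr_entry_le_mxip (M k) i j) (Mc k).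
  rewrite ler_norml; nra.
exists (\matrix_(i, j) L (i, j)) => i j; rewrite mxE; exact: (HL (i, j)).
Qed.

End UltraLimits.
Arguments mcvg_cst {R p q} L.

(** * The trace inner product *)

Section MatrixInnerProduct.
Context {R : realType}.

Section Bilinear.
Variables p q : nat.
Implicit Types M N K : 'M[R]_(p, q).

Lemma mxipC M N : mxip M N = mxip N M.
Proof. by rewrite /mxip -mxtrace_tr trmx_mul trmxK. Qed.

Lemma mxipDr M N K : mxip M (N + K) = mxip M N + mxip M K.
Proof. by rewrite /mxip mulmxDr raddfD. Qed.

Lemma mxipDl M N K : mxip (M + N) K = mxip M K + mxip N K.
Proof. by rewrite mxipC mxipDr !(mxipC K). Qed.

Lemma mxipZr c M N : mxip M (c *: N) = c * mxip M N.
Proof. by rewrite /mxip -scalemxAr mxtraceZ. Qed.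

Lemma mxipZl c M N : mxip (c *: M) N = c * mxip M N.
Proof. by rewrite mxipC mxipZr mxipC. Qed.

Lemma mxipNr M N : mxip M (- N) = - mxip M N.
Proof. by rewrite -scaleN1r mxipZr mulN1r. Qed.

Lemma mxipNl M N : mxip (- M) N = - mxip M N.
Proof. by rewrite -scaleN1r mxipZl mulN1r. Qed.

Lemma mxipBr M N K : mxip M (N - K) = mxip M N - mxip M K.
Proof. by rewrite mxipDr mxipNr. Qed.

Lemma mxipBl M N K : mxip (M - N) K = mxip M K - mxip N K.
Proof. by rewrite mxipDl mxipNl. Qed.

Lemma mxip0r M : mxip M 0 = 0.
Proof. by rewrite /mxip mulmx0 mxtrace0. Qed.

Lemma mxip0l M : mxip 0 M = 0.
Proof. by rewrite mxipC mxip0r. Qed.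

Lemma mxip_ge0 M : 0 <= mxip M M.
Proof.
by rewrite mxipE; apply: sumr_ge0 => i _; apply: sumr_ge0 => j _; rewrite -expr2 sqr_ge0.
Qed.

Lemma mxip_eq0 M : mxip M M = 0 -> M = 0.
Proof.
move=> M0; apply/matrixP => i j; rewrite mxE; apply/eqP.
by rewrite -sqrf_eq0 eq_le sqr_ge0 andbT -M0 sqr_entry_le_mxip.
Qed.

Lemma mxip_gt0 M : M != 0 -> 0 < mxip M M.
Proof.
by move=> M0; rewrite lt_def mxip_ge0 andbT; apply: contraNneq M0 => /mxip_eq0 ->.
Qed.

Lemma mxip_CS_sqr M N : mxip M N ^+ 2 <= mxip M M * mxip N N.
Proof.
have [->|N0] := eqVneq N 0; first by rewrite !mxip0r expr0n /= mulr0.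
have Ngt := mxip_gt0 N0.
have := mxip_ge0 (mxip N N *: M - mxip M N *: N).
rewrite mxipBl !mxipBr !mxipZl !mxipZr (mxipC N M) => h.
have : 0 <= mxip N N * (mxip M M * mxip N N - mxip M N ^+ 2) by nra.
by rewrite pmulr_rge0 // subr_ge0.
Qed.

Definition fro M := Num.sqrt (mxip M M).

Lemma fro_ge0 M : 0 <= fro M. Proof. exact: sqrtr_ge0. Qed.

Lemma sqr_fro M : fro M ^+ 2 = mxip M M.
Proof. by rewrite sqr_sqrtr // mxip_ge0. Qed.

Lemma fro_eq0 M : fro M = 0 -> M = 0.
Proof. by move=> h; apply: mxip_eq0; rewrite -sqr_fro h expr0n. Qed.

Lemma fro0 : fro 0 = 0.
Proof. by rewrite /fro mxip0r sqrtr0. Qed.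

Lemma fro_gt0 M : M != 0 -> 0 < fro M.
Proof.
by move=> M0; rewrite lt_def fro_ge0 andbT; apply: contraNneq M0 => /fro_eq0 ->.
Qed.

Lemma mxip_CS M N : `|mxip M N| <= fro M * fro N.
Proof.
rewrite -(@ler_pXn2r _ 2) ?nnegrE ?mulr_ge0 ?fro_ge0 ?normr_ge0 //.
by rewrite exprMn !sqr_fro -normrX ger0_norm ?sqr_ge0 // mxip_CS_sqr.
Qed.

Lemma froZ c M : fro (c *: M) = `|c| * fro M.
Proof. by rewrite /fro mxipZl mxipZr mulrA -expr2 sqrtrM ?sqr_ge0 // sqrtr_sqr. Qed.

Lemma froN M : fro (- M) = fro M.
Proof. by rewrite -scaleN1r froZ normrN1 mul1r. Qed.

Lemma froB_sym M N : fro (M - N) = fro (N - M).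
Proof. by rewrite -froN opprB. Qed.

Lemma froD M N : fro (M + N) <= fro M + fro N.
Proof.
rewrite -(@ler_pXn2r _ 2) ?nnegrE ?addr_ge0 ?fro_ge0 //.
rewrite sqr_fro mxipDl !mxipDr -!sqr_fro (mxipC N M).
have := le_trans (ler_norm _) (mxip_CS M N); nra.
Qed.

Lemma fro_le M c : 0 <= c -> mxip M M <= c ^+ 2 -> fro M <= c.
Proof.
by move=> c0; rewrite -sqr_fro ler_pXn2r // ?nnegrE // fro_ge0.
Qed.

Lemma mxip_le_fro M c : fro M <= c -> mxip M M <= c ^+ 2.
Proof.
by move=> h; rewrite -sqr_fro ler_pXn2r // nnegrE ?fro_ge0 // (le_trans (fro_ge0 M)).
Qed.

End Bilinear.

Lemma mxip_mull p q r (M : 'M[R]_(p, q)) (N : 'M_(q, r)) (K : 'M_(p, r)) :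
  mxip (M *m N) K = mxip N (M^T *m K).
Proof. by rewrite /mxip trmx_mul mulmxA. Qed.

Lemma mxip_mulr p q r (M : 'M[R]_(p, q)) (N : 'M_(q, r)) (K : 'M_(p, r)) :
  mxip (M *m N) K = mxip M (K *m N^T).
Proof. by rewrite /mxip trmx_mul -mulmxA mxtrace_mulC mulmxA. Qed.

Lemma mxip_tr p q (M N : 'M[R]_(p, q)) : mxip M^T N^T = mxip M N.
Proof. by rewrite /mxip trmxK mxtrace_mulC -/(mxip N M) mxipC. Qed.

Lemma fro_tr p q (M : 'M[R]_(p, q)) : fro M^T = fro M.
Proof. by rewrite /fro mxip_tr. Qed.

(** Each entry of [M *m N] is the inner product of a row and a column, so this is
Cauchy-Schwarz entry by entry. *)
Lemma mxip_mulmx_le p q r (M : 'M[R]_(p, q)) (N : 'M_(q, r)) :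
  mxip (M *m N) (M *m N) <= mxip M M * mxip N N.
Proof.
rewrite [leLHS]mxipE.
apply: (@le_trans _ _ (\sum_i \sum_j
   mxip (row i M)^T (row i M)^T * mxip (col j N) (col j N))).
  apply: ler_sum => i _; apply: ler_sum => j _.
  apply: le_trans (mxip_CS_sqr _ _).
  suff -> : (M *m N) i j = mxip (row i M)^T (col j N) by rewrite expr2.
  rewrite mxipE mxE; apply: eq_bigr => t _.
  by rewrite big_ord1 !mxE.
under eq_bigr do rewrite -mulr_sumr.
rewrite -mulr_suml; apply: ler_pM => //.
- by apply: sumr_ge0 => i _; exact: mxip_ge0.
- by apply: sumr_ge0 => i _; exact: mxip_ge0.
- rewrite [leRHS]mxipE; apply: ler_sum => i _; rewrite mxipE.
  by apply: ler_sum => t _; rewrite big_ord1 !mxE.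
- rewrite [leRHS]mxipE [leRHS]exchange_big /=; apply: ler_sum => i _; rewrite mxipE.
  by apply: ler_sum => t _; rewrite big_ord1 !mxE.
Qed.

Lemma fro_mulmx p q r (M : 'M[R]_(p, q)) (N : 'M_(q, r)) :
  fro (M *m N) <= fro M * fro N.
Proof.
apply: fro_le; first by rewrite mulr_ge0 ?fro_ge0.
by rewrite exprMn !sqr_fro mxip_mulmx_le.
Qed.

End MatrixInnerProduct.

(** * The spectral theorem for real symmetric matrices *)
Section Spectral.
Context {R : realType}.

Definition psdmx {n} (M : 'M[R]_n) := forall u : 'cV_n, 0 <= mxip u (M *m u).

(** The quadratic form has a minimum at [u], so its gradient [2 M u] vanishes; here
this is tested by a small step from [u] in the direction [- M u]. *)
Lemma psdmx_ker n (M : 'M[R]_n) (u : 'cV_n) : M^T = M -> psdmx M ->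
  mxip u (M *m u) = 0 -> M *m u = 0.
Proof.
move=> Ms Mpsd Mu0; apply: mxip_eq0; set w := M *m u.
have := mxip_ge0 w; set a := mxip w w => a0.
have := Mpsd w; set c := mxip w (M *m w) => c0.
(* any step smaller than 2 a / c makes the form negative unless a = 0 *)
pose t := a / (c + 1).
have tE : t * (c + 1) = a by rewrite /t mulfVK // gt_eqF // ltr_wpDl.
have := Mpsd (u - t *: w).
rewrite mulmxBr -scalemxAr -/w mxipBl !mxipBr !mxipZl !mxipZr -/c -/a.
have -> : mxip u (M *m w) = a by rewrite -[M]Ms -mxip_mull.
rewrite /w Mu0 -/w => h; have t0 : 0 <= t by rewrite divr_ge0 // ltW // ltr_wpDl.
nra.
Qed.

(** If the Rayleigh quotient is maximal at [u] with value [l], then [l - M] is psd and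
its form vanishes at [u], hence it annihilates [u]. *)
Lemma rayleigh_max n (M : 'M[R]_n.+1) : M^T = M ->
  exists (u : 'cV_n.+1) (l : R),
    [/\ mxip u u = 1, forall v : 'cV[R]_n.+1, mxip v (M *m v) <= l * mxip v v & M *m u = l *: u].
Proof.
move=> Ms.
pose E := [set mxip v (M *m v) | v in [set v : 'cV[R]_n.+1 | mxip v v = 1]].
have E0 : E !=set0.
  pose e : 'cV[R]_n.+1 := delta_mx 0 0; exists (mxip e (M *m e)), e => //=.
  by rewrite /mxip trmx_delta mul_delta_mx /mxtrace big_ord1 !mxE !eqxx.
have Eub : has_ubound E.
  exists (mxip M M + 1) => _ /= [v v1 <-].
  have := mxip_CS_sqr v (M *m v); have := mxip_mulmx_le M v.
  have := mxip_ge0 M; rewrite v1; nra.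
have bd (v : 'cV[R]_n.+1) : mxip v (M *m v) <= sup E * mxip v v.
  have [->|v0] := eqVneq v 0; first by rewrite mulmx0 !mxip0r mulr0.
  have f0 := fro_gt0 v0.
  have : E (mxip ((fro v)^-1 *: v) (M *m ((fro v)^-1 *: v))).
    exists ((fro v)^-1 *: v) => //=.
    by rewrite mxipZl mxipZr -sqr_fro mulrA -expr2 -exprMn mulVf ?expr1n ?gt_eqF.
  move=> /(ub_le_sup Eub).
  rewrite -scalemxAr mxipZl mxipZr -sqr_fro mulrA -expr2 exprVn mulrC.
  by rewrite ler_pdivrMr // exprn_gt0.
have /choice[v Hv] : forall k : nat, exists v : 'cV[R]_n.+1,
    mxip v v = 1 /\ sup E - k.+1%:R^-1 <= mxip v (M *m v).
  move=> k; have [|_ [v v1 <-] h] := @sup_adherent R E k.+1%:R^-1 _ (conj E0 Eub).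
    by rewrite invr_gt0 ltr0n.
  by exists v; split=> //; exact: ltW.
have [|u vu] := @mcvg_exists R _ _ v 1; first by move=> k; rewrite (Hv k).1.
have u1 : mxip u u = 1.
  apply: ulim_unique (ulim_mxip vu vu) _.
  by apply: ulim_const => k; rewrite (Hv k).1.
have uM : mxip u (M *m u) = sup E.
  apply/eqP; rewrite eq_le; apply/andP; split.
    by have := bd u; rewrite u1 mulr1.
  have h1 : (fun k => sup E - k.+1%:R^-1) @ omega --> (sup E - 0 : R).
    by apply: ulimB; [exact: ulim_const|exact: ulim_harmonic].
  have h2 := ulim_mxip vu (mcvgM (mcvg_cst M) vu).
  by have := ulim_le h1 h2 (fun k => (Hv k).2); rewrite subr0.
exists u, (sup E); split=> //.
have : ((sup E)%:M - M) *m u = 0.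
  apply: psdmx_ker.
  - by rewrite linearB /= tr_scalar_mx Ms.
  - by move=> w; rewrite mulmxBl mxipBr mul_scalar_mx mxipZr subr_ge0 bd.
  - by rewrite mulmxBl mxipBr mul_scalar_mx mxipZr u1 uM mulr1 subrr.
by rewrite mulmxBl mul_scalar_mx => /eqP; rewrite subr_eq0 => /eqP.
Qed.

(** The witness is the Householder reflection exchanging [e] and [u]. *)
Lemma unit_vector_extends n (e u : 'cV[R]_n) : mxip e e = 1 -> mxip u u = 1 ->
  exists H : 'M[R]_n, [/\ H^T = H, H *m H = 1%:M & H *m e = u].
Proof.
move=> e1 u1; pose w := e - u.
have [w0|w0] := eqVneq w 0.
  exists 1%:M; rewrite trmx1 !mul1mx; split=> //.
  by apply/eqP; rewrite -subr_eq0 -/w w0.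
have wgt := mxip_gt0 w0.
have wT v : w *m (w^T *m v) = mxip w v *: w.
  rewrite [w^T *m v]mx11_scalar mul_mx_scalar; congr (_ *: _).
  by rewrite /mxip /mxtrace big_ord1.
pose c := 2 / mxip w w.
exists (1%:M - c *: (w *m w^T)); split.
- by rewrite linearB linearZ /= trmx1 trmx_mul trmxK.
- have KK : (w *m w^T) *m (w *m w^T) = mxip w w *: (w *m w^T).
    by rewrite mulmxA -(mulmxA w) wT -scalemxAl.
  have c2 : c * mxip w w = 2 by rewrite /c mulfVK // gt_eqF.
  rewrite mulmxBl mul1mx mulmxBr mulmx1 -scalemxAl -scalemxAr KK !scalerA.
  rewrite -mulrA c2; move: (w *m w^T) (1%:M : 'M[R]_n) => K I.
  by apply/matrixP => i j; rewrite !mxE; ring.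
- rewrite mulmxBl mul1mx -scalemxAl -mulmxA wT scalerA.
  have -> : c * mxip w e = 1.
    have we : mxip w w = 2 * mxip w e.
      rewrite {1 2 3}/w !(mxipBl, mxipBr) e1 u1 (mxipC u e); ring.
    by rewrite /c mulrAC -we divff // gt_eqF.
  by rewrite scale1r /w opprB addrC subrK.
Qed.

Lemma diag_mxE n (P : 'M[R]_n) (d : 'rV_n) (i : 'I_n) :
  P^T *m P = 1%:M ->
  d 0 i = mxip (P *m delta_mx i 0 : 'cV_n)
               (P *m diag_mx d *m P^T *m (P *m delta_mx i 0)).
Proof.
move=> PP; rewrite -!mulmxA (mulmxA P^T) PP mul1mx mxip_mull !mulmxA PP mul1mx.
rewrite /mxip trmx_delta mulmxA -rowE row_diag_mx -scalemxAl mul_delta_mx.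
by rewrite mxtraceZ /mxtrace big_ord1 !mxE !eqxx mulr1.
Qed.

Lemma mxip_orth_delta n (P : 'M[R]_n) (i : 'I_n) : P^T *m P = 1%:M ->
  mxip (P *m delta_mx i 0 : 'cV_n) (P *m delta_mx i 0) = 1.
Proof.
move=> PP; rewrite mxip_mull !mulmxA PP mul1mx.
by rewrite /mxip trmx_delta mul_delta_mx /mxtrace big_ord1 !mxE !eqxx.
Qed.

(** Splitting off an eigenvector of the largest eigenvalue at each step makes the
diagonal nonincreasing without any sorting: every later diagonal entry is a value
of the same Rayleigh quotient. *)
Lemma symmetric_diagonalization n (M : 'M[R]_n) : M^T = M ->
  exists (P : 'M[R]_n) (d : 'rV[R]_n),
    [/\ P^T *m P = 1%:M, M = P *m diag_mx d *m P^T &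
        forall i j : 'I_n, (i <= j)%N -> d 0 j <= d 0 i].
Proof.
elim: n M => [|n IH] M Ms.
  exists 1%:M, 0; split; [by apply/matrixP => -[]|by apply/matrixP => -[]|by case].
have [u [l [u1 lmax Mu]]] := rayleigh_max Ms.
pose e : 'cV[R]_(1 + n) := col_mx 1%:M 0.
have e1 : mxip e e = 1.
  by rewrite /mxip tr_col_mx mul_row_col trmx1 trmx0 mulmx1 mulmx0 addr0 mxtrace1.
have [H [HT HH He]] := unit_vector_extends e1 u1.
pose M1 : 'M[R]_(1 + n) := H *m M *m H.
have M1s : M1^T = M1 by rewrite /M1 !trmx_mul HT Ms mulmxA.
have M1e : M1 *m e = l *: e.
  by rewrite /M1 -mulmxA He -mulmxA Mu -scalemxAr -He mulmxA HH mul1mx.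
have lM1 : lsubmx M1 = l *: e.
  by rewrite -M1e -{2}[M1]hsubmxK mul_row_col mulmx1 mulmx0 addr0.
have c0 i : M1 i (lshift n 0) = l * e i 0.
  by have := congr1 (fun Z : 'M_(_, 1) => Z i 0) lM1; rewrite !mxE.
pose M' := drsubmx M1.
have M's : M'^T = M' by rewrite /M' trmx_drsub M1s.
have M1E : M1 = block_mx l%:M 0 0 M'.
  rewrite -[LHS]submxK; congr block_mx.
  - by apply/matrixP => i j; rewrite !ord1 2![LHS]mxE c0 col_mxEu !mxE eqxx !mulr1.
  - apply/matrixP => i j; rewrite 2![LHS]mxE -[M1]trmxK mxE M1s ord1 c0.
    by rewrite col_mxEd !mxE mulr0.
  - apply/matrixP => i j; rewrite 2![LHS]mxE ord1 c0 col_mxEd !mxE mulr0 //.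
have [P' [d' [PP' M'E d'le]]] := IH _ M's.
pose Q : 'M[R]_(1 + n) := block_mx 1%:M 0 0 P'.
have PP : (H *m Q)^T *m (H *m Q) = 1%:M.
  rewrite trmx_mul HT mulmxA -(mulmxA Q^T) HH mulmx1.
  rewrite tr_block_mx mulmx_block !trmx0 trmx1 !mulmx0 !mul0mx !addr0 !add0r.
  by rewrite mulmx1 PP' -scalar_mx_block.
have ME : M = (H *m Q) *m diag_mx (row_mx (l%:M : 'rV_1) d') *m (H *m Q)^T.
  rewrite diag_mx_row trmx_mul HT -!mulmxA.
  have -> : Q *m (block_mx (diag_mx l%:M) 0 0 (diag_mx d') *m (Q^T *m H)) = M1 *m H.
    rewrite !mulmxA; congr (_ *m _).
    rewrite M1E tr_block_mx !mulmx_block !trmx0 trmx1 !mulmx0 !mul0mx !addr0 !add0r.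
    rewrite ?mulmx1 ?mul1mx -M'E; congr block_mx.
      by apply/matrixP => i j; rewrite !ord1 !mxE eqxx.
    by rewrite mul0mx.
  by rewrite /M1 -!mulmxA HH mulmx1 mulmxA HH mul1mx.
exists (H *m Q), (row_mx (l%:M : 'rV_1) d'); split=> //.
have dl (j : 'I_(1 + n)) : (row_mx (l%:M : 'rV_1) d') 0 j <= l.
  rewrite (diag_mxE _ j PP) -ME (le_trans (lmax _)) //.
  by rewrite (mxip_orth_delta _ PP) mulr1.
suff dle (i j : 'I_(1 + n)) : (i <= j)%N ->
    (row_mx (l%:M : 'rV_1) d') 0 j <= (row_mx (l%:M : 'rV_1) d') 0 i by exact: dle.
have [i' ->|i' ->] := split_ordP i.
  by move=> _; rewrite [leRHS]row_mxEl ord1 [leRHS]mxE eqxx; exact: dl.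
have [j' ->|j' ->] := split_ordP j; first by rewrite /= ord1.
by rewrite !row_mxEr /= leq_add2l => /d'le.
Qed.

Lemma char_poly_orth_diag n (P : 'M[R]_n) (d : 'rV[R]_n) : P^T *m P = 1%:M ->
  char_poly (P *m diag_mx d *m P^T) = \prod_(i < n) ('X - (d 0 i)%:P).
Proof.
move=> PP; have PPt := mulmx1C PP.
transitivity (char_poly (diag_mx d)); last first.
  rewrite char_poly_trig ?diag_mx_is_trig //.
  by apply: eq_bigr => i _; rewrite mxE eqxx.
rewrite /char_poly.
have -> : char_poly_mx (P *m diag_mx d *m P^T) =
    map_mx polyC P *m char_poly_mx (diag_mx d) *m map_mx polyC P^T.
  rewrite /char_poly_mx mulmxBr mulmxBl !map_mxM; congr (_ - _).
  by rewrite scalar_mxC -mulmxA -map_mxM PPt map_mx1 mulmx1.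
rewrite !det_mulmx mulrAC -det_mulmx -map_mxM PPt map_mx1 det1 mul1r //.
Qed.

(** The link between diagonalizations and [lambda], which is defined from the roots of
the characteristic polynomial: both lists have the same multiplicities and both are
sorted. *)
Lemma lambda_unique n (P : 'M[R]_n) (d : 'rV[R]_n) : P^T *m P = 1%:M ->
  (forall i j : 'I_n, (i <= j)%N -> d 0 j <= d 0 i) ->
  lambda (P *m diag_mx d *m P^T) = d.
Proof.
move=> PP dle; set M := _ *m P^T.
pose s := [seq d 0 i | i <- enum 'I_n].
have cE : char_poly M = \prod_(y <- s) ('X - y%:P).
  by rewrite char_poly_orth_diag // big_map big_enum.
have pe : perm_eq (flatten [seq nseq (mup x (char_poly M)) x | x <- rootsR (char_poly M)]) s.
  apply/allP => x _ /=; apply/eqP.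
  have c0 : char_poly M != 0 by rewrite monic_neq0 // char_poly_monic.
  rewrite count_flatten -map_comp sumnE big_map.
  under eq_bigr do rewrite /= count_nseq.
  have [xr|xr] := boolP (x \in rootsR (char_poly M)).
    rewrite (bigD1_seq x) //= ?uniq_roots // eqxx mul1n big1 ?addn0.
      by rewrite cE mu_prod_XsubC.
    by move=> y /negPf ->; rewrite mul0n.
  rewrite big1_seq.
    move: xr; rewrite -roots_on_rootsR // cE root_prod_XsubC => /count_memPn -> //.
  move=> y /andP[_ yr]; rewrite (_ : pred1 x y = false) ?mul0n //=.
  by apply: contraNF xr => /eqP <-.
have ss : sorted (fun x y => y <= x) s.
  rewrite sorted_map; apply: (@sub_sorted _ (relpre val leq)) => [i j /=|].
    exact: dle.
  by rewrite -sorted_map val_enum_ord iota_sorted.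
have eE : eigs M = s.
  rewrite /eigs; apply: (@sorted_eq _ (fun x y : R => y <= x)) => //.
  - by move=> x y z /= xy yz; apply: le_trans yz xy.
  - by move=> x y /=; rewrite andbC => /le_anti.
  - by apply: sort_sorted => x y; exact: le_total.
  - by apply: perm_trans pe; rewrite perm_sort.
apply/rowP => i; rewrite mxE eE (nth_map i) ?size_enum_ord // nth_ord_enum //.
Qed.

End Spectral.

(** * Positive semidefinite matrices *)

Section PsdCone.
Context {R : realType}.

Lemma mxip_delta n (M : 'M[R]_n) (i : 'I_n) :
  mxip (delta_mx i 0 : 'cV_n) (M *m delta_mx i 0) = M i i.
Proof.
by rewrite /mxip trmx_delta mulmxA -rowE -colE /mxtrace big_ord1 !mxE.
Qed.

Lemma psdmx_diag_ge0 n (M : 'M[R]_n) i : psdmx M -> 0 <= M i i.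
Proof. by move=> /(_ (delta_mx i 0)); rewrite mxip_delta. Qed.

Lemma psdmx_tr_ge0 n (M : 'M[R]_n) : psdmx M -> 0 <= \tr M.
Proof. by move=> Mp; apply: sumr_ge0 => i _; exact: psdmx_diag_ge0. Qed.

Lemma psdmx_conj n p (M : 'M[R]_n) (K : 'M_(n, p)) :
  psdmx M -> psdmx (K^T *m M *m K).
Proof. by move=> Mp u; rewrite -!mulmxA -mxip_mull; apply: Mp. Qed.

Lemma psdmx1 n : psdmx (1%:M : 'M[R]_n).
Proof. by move=> u; rewrite mul1mx mxip_ge0. Qed.

Lemma psdmx_sqr n (M : 'M[R]_n) : M^T = M -> psdmx (M *m M).
Proof. by move=> Ms u; rewrite -mulmxA -{1}Ms -mxip_mull mxip_ge0. Qed.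

(** In an eigenbasis of [M], both traces are combinations of the diagonal entries of
[N] in that basis, which are nonnegative, and each eigenvalue of [M] is at most
[\tr M]. *)
Lemma psdmx_trace_mul n (M N : 'M[R]_n) : M^T = M -> psdmx M -> psdmx N ->
  0 <= \tr (M *m N) /\ \tr (M *m M *m N) <= \tr M * \tr (M *m N).
Proof.
move=> Ms Mp Np; have [P [d [PP ME _]]] := symmetric_diagonalization Ms.
have d0 i : 0 <= d 0 i by rewrite (diag_mxE _ i PP) -ME.
pose N' := P^T *m N *m P; have N'p : psdmx N' by exact: psdmx_conj.
have trD (e : 'rV_n) : \tr (P *m diag_mx e *m P^T *m N) = \sum_i e 0 i * N' i i.
  rewrite -!mulmxA mxtrace_mulC -!mulmxA (mulmxA P^T) -/N'.
  by apply: eq_bigr => i _; rewrite mul_diag_mx mxE.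
have trM : \tr M = \sum_i d 0 i.
  by rewrite ME mxtrace_mulC mulmxA PP mul1mx mxtrace_diag.
have MM : M *m M = P *m diag_mx (\row_i (d 0 i ^+ 2)) *m P^T.
  rewrite ME -!mulmxA (mulmxA P^T) PP mul1mx (mulmxA (diag_mx d)).
  by rewrite mulmx_diag.
split; first by rewrite ME trD; apply: sumr_ge0 => i _; rewrite mulr_ge0 ?psdmx_diag_ge0.
rewrite MM trD {2}ME trD mulr_sumr; apply: ler_sum => i _.
rewrite mxE expr2 -mulrA ler_wpM2r ?mulr_ge0 ?psdmx_diag_ge0 //.
by rewrite trM (bigD1 i) //= lerDl sumr_ge0.
Qed.

(** Complementarity controls the product: when [mxip M N] is of second order, the
product [M *m N] is of first order. *)
Lemma psdmx_mulmx_bound n (M N : 'M[R]_n) : M^T = M -> N^T = N ->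
  psdmx M -> psdmx N ->
  mxip (M *m N) (M *m N) <= \tr M * \tr N * mxip M N.
Proof.
move=> Ms Ns Mp Np.
have -> : mxip (M *m N) (M *m N) = \tr (M *m M *m (N *m N)).
  by rewrite /mxip trmx_mul Ms Ns !mulmxA [RHS]mxtrace_mulC !mulmxA.
apply: le_trans (psdmx_trace_mul Ms Mp (psdmx_sqr Ns)).2 _.
rewrite -mulrA ler_wpM2l ?psdmx_tr_ge0 //.
rewrite mxtrace_mulC /mxip Ms (mxtrace_mulC M).
exact: (psdmx_trace_mul Ns Np Mp).2.
Qed.

Lemma psdmx_fro_le_tr n (M : 'M[R]_n) : M^T = M -> psdmx M -> fro M <= \tr M.
Proof.
move=> Ms Mp; apply: fro_le; first exact: psdmx_tr_ge0.
have := (psdmx_trace_mul Ms Mp (@psdmx1 n)).2.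
by rewrite !mulmx1 /mxip Ms expr2.
Qed.

Lemma mxtrace_le_fro n (M : 'M[R]_n) : \tr M <= fro (1%:M : 'M[R]_n) * fro M.
Proof.
apply: le_trans (ler_norm _) _.
by have := mxip_CS (1%:M : 'M[R]_n) M; rewrite /mxip trmx1 mul1mx.
Qed.

Section SymM.
Variable n : nat.
Implicit Types X S W : symM R n.

Lemma symM_tr X : (X : 'M[R]_n)^T = X.
Proof. by apply/eqP; rewrite -symmxE; case: X. Qed.

Lemma psdP X : psd X <-> psdmx (X : 'M[R]_n).
Proof.
have E (u : 'cV[R]_n) : (u^T *m (X : 'M[R]_n) *m u) 0 0 = mxip u ((X : 'M[R]_n) *m u).
  by rewrite /mxip /mxtrace big_ord1 mulmxA.
by split=> h u; [rewrite -E; exact: h|rewrite E; exact: h].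
Qed.

Lemma outer_sym (u : 'cV[R]_n) : u *m u^T \in symmx R n.
Proof. by rewrite symmxE trmx_mul trmxK. Qed.

Definition outer u : symM R n := SymM (outer_sym u).

Lemma outer_form u v : mxip v (outer u *m v) = mxip u v ^+ 2.
Proof.
rewrite /= -mulmxA [u^T *m v]mx11_scalar mul_mx_scalar mxipZr (mxipC v).
by rewrite expr2; congr (_ * _); rewrite /mxip /mxtrace big_ord1.
Qed.

Lemma outer_psd u : psd (outer u).
Proof. by apply/psdP => v; rewrite outer_form sqr_ge0. Qed.

Lemma mxip_outer (M : 'M[R]_n) u : mxip M (outer u) = mxip u (M *m u).
Proof.
by rewrite /= mxipC mxip_mulr trmxK.
Qed.

Lemma symipNl X S : symip (- X) S = - symip X S.
Proof. exact: mxipNl. Qed.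

(** Test the normal cone inequality at [0], at [2 X] and at [X + u u^T]. *)
Lemma normal_cone_psdP X S : psd X ->
  normal_cone symip psd X S <-> psd (- S) /\ symip S X = 0.
Proof.
move=> Xp; split=> [h|[Sn SX] X' X'p].
  have SX : symip S X = 0.
    apply/eqP; rewrite eq_le; apply/andP; split.
      have := h (X + X) _; rewrite addrK; apply.
      by move=> u; rewrite mulmxDr mulmxDl mxE addr_ge0 //; apply: Xp.
    have := h 0 _; rewrite sub0r /symip mxipNr oppr_le0; apply.
    by move=> u; rewrite mulmx0 mul0mx mxE.
  split=> //; apply/psdP => u.
  have := h _ (outer_psd u); rewrite /symip mxipBr -/(symip S X) SX subr0 mxip_outer.
  by rewrite mulNmx mxipNr oppr_ge0.
have := (psdmx_trace_mul (symM_tr X') ((psdP _).1 X'p) ((psdP _).1 Sn)).1.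
rewrite /symip mxipBr -/(symip S X) SX subr0 mxtrace_mulC /mxip symM_tr.
by rewrite mulNmx raddfN oppr_ge0.
Qed.

Lemma normal_cone_mulmx0 X S : psd X -> normal_cone symip psd X S ->
  X *m S = 0 /\ S *m X = 0.
Proof.
move=> Xp /(normal_cone_psdP _ Xp)[Sn SX].
have XS0 : mxip X (- (S : 'M[R]_n)) = 0 by rewrite mxipNr mxipC [mxip _ _]SX oppr0.
have := psdmx_mulmx_bound (symM_tr X) (symM_tr (- S)) ((psdP _).1 Xp) ((psdP _).1 Sn).
rewrite [val (- S)]/(- (S : 'M_n)) XS0 mulr0 => h.
have {h}XS : X *m (- (S : 'M[R]_n)) = 0 by apply/mxip_eq0/le_anti; rewrite h mxip_ge0.
have : X *m S = 0 by apply/eqP; rewrite -oppr_eq0 -mulmxN XS.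
move=> XS'; split=> //; apply: trmx_inj.
by rewrite trmx_mul !symM_tr XS' trmx0.
Qed.

End SymM.
End PsdCone.

(** * Common eigenframes *)
Section Frames.
Context {R : realType} {n : nat}.
Implicit Types X S W : symM R n.

Lemma eigenframe_exists X : exists P, eigenframes X P.
Proof.
have [P [d [PP XE dle]]] := symmetric_diagonalization (symM_tr X).
by exists P; split=> //; rewrite [X in lambda X]XE lambda_unique.
Qed.

Lemma lambda_noninc X (i j : 'I_n) : (i <= j)%N -> lambda X 0 j <= lambda X 0 i.
Proof.
have [P [d [PP XE dle]]] := symmetric_diagonalization (symM_tr X).
by move=> ij; rewrite XE lambda_unique // dle.
Qed.

Lemma lambda_psd_ge0 X i : psd X -> 0 <= lambda X 0 i.
Proof.
move=> /psdP Xp; have [P [PP XE]] := eigenframe_exists X.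
by rewrite (diag_mxE _ i PP) -XE.
Qed.

Lemma eigenframe_of_noninc X P (d : 'rV[R]_n) : P^T *m P = 1%:M ->
  X = P *m diag_mx d *m P^T :> 'M_n -> (forall i j : 'I_n, (i <= j)%N -> d 0 j <= d 0 i) ->
  eigenframes X P.
Proof. by move=> PP XE dle; split=> //; rewrite [X in lambda X]XE lambda_unique. Qed.

(** Any sorted eigenframe of [X + S] will do.  In such a frame [X'] and [S'] multiply to
zero and add up to a diagonal matrix [z], so that [X' X' = X' z] and [S' S' = S' z].
On the diagonal, this says that the squared norm of row [i] of [X'] is [z_i X'_ii],
which is nonpositive when [z_i <= 0], and likewise for [S'] when [z_i >= 0]: in
each row one of the two matrices vanishes and the other one is diagonal. *)
Lemma common_eigenframe X S : psd X -> normal_cone symip psd X S ->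
  exists P, (eigenframes X `&` eigenframes S) P.
Proof.
move=> Xp SN; have [XS SX] := normal_cone_mulmx0 Xp SN.
have [Sn _] := (normal_cone_psdP _ Xp).1 SN.
have [P [z [PP ZE zle]]] := symmetric_diagonalization (symM_tr (X + S)).
have PPt := mulmx1C PP.
pose X' := P^T *m X *m P; pose S' := P^T *m S *m P.
have X'p : psdmx X' by apply: psdmx_conj; apply/psdP.
have S'n : psdmx (- S').
  by rewrite /S' -mulNmx -mulmxN; apply: psdmx_conj; move/psdP: Sn.
have X's : X'^T = X' by rewrite /X' !trmx_mul trmxK symM_tr mulmxA.
have S's : S'^T = S' by rewrite /S' !trmx_mul trmxK symM_tr mulmxA.
have sumE : X' + S' = diag_mx z.
  rewrite /X' /S' -mulmxDl -mulmxDr -[X + S :> 'M_n]/(val (X + S)) /= in ZE *.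
  by rewrite ZE -!mulmxA PP mulmx1 mulmxA PP mul1mx.
have X'S' : X' *m S' = 0.
  by rewrite /X' /S' -!mulmxA (mulmxA P) PPt mul1mx (mulmxA X) XS mul0mx mulmx0.
have S'X' : S' *m X' = 0 by rewrite -X's -S's -trmx_mul X'S' trmx0.
have rowsq (Y : 'M[R]_n) i : Y^T = Y -> (Y *m Y) i i = \sum_j Y i j ^+ 2.
  move=> Ys; rewrite mxE; apply: eq_bigr => j _.
  by rewrite -{2}Ys mxE expr2.
have row0 (Y : 'M[R]_n) i : Y^T = Y -> (Y *m Y) i i <= 0 -> forall j, Y i j = 0.
  move=> Ys; rewrite rowsq // => h j; apply/eqP; rewrite -sqrf_eq0 eq_le sqr_ge0 andbT.
  by apply: le_trans h; rewrite (bigD1 j) //= lerDl sumr_ge0 // => k _; rewrite sqr_ge0.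
have diagr (Y : 'M[R]_n) i j : (Y *m diag_mx z) i j = Y i j * z 0 j.
  by rewrite mul_mx_diag mxE.
have X'row i : z 0 i <= 0 -> forall j, X' i j = 0.
  move=> zi; apply: row0 => //.
  rewrite (_ : X' *m X' = X' *m diag_mx z); last by rewrite -sumE mulmxDr X'S' addr0.
  by rewrite diagr mulr_ge0_le0 // psdmx_diag_ge0.
have S'row i : 0 <= z 0 i -> forall j, S' i j = 0.
  move=> zi; apply: row0 => //.
  rewrite (_ : S' *m S' = S' *m diag_mx z); last by rewrite -sumE mulmxDr S'X' add0r.
  rewrite diagr mulr_le0_ge0 // -oppr_ge0.
  by have := psdmx_diag_ge0 i S'n; rewrite mxE.
have sumij i j : X' i j + S' i j = z 0 i *+ (i == j).
  by have := congr1 (fun M : 'M_n => M i j) sumE; rewrite [LHS]mxE [RHS]mxE.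
have X'E : X' = diag_mx (\row_i Num.max (z 0 i) 0).
  apply/matrixP => i j; rewrite [RHS]mxE [X in _ = X *+ _]mxE.
  have [z0|z0] := leP 0 (z 0 i); first by rewrite -sumij S'row ?addr0.
  by rewrite X'row ?ltW ?mul0rn.
have S'E : S' = diag_mx (\row_i Num.min (z 0 i) 0).
  apply/matrixP => i j; rewrite [RHS]mxE [X in _ = X *+ _]mxE.
  have [z0|z0] := leP (z 0 i) 0; first by rewrite -sumij X'row ?add0r.
  by rewrite S'row ?ltW ?mul0rn.
have back (Y : 'M[R]_n) : P *m (P^T *m Y *m P) *m P^T = Y.
  by rewrite -!mulmxA PPt mulmx1 mulmxA PPt mul1mx.
exists P; split.
  apply: (@eigenframe_of_noninc _ _ (\row_i Num.max (z 0 i) 0) PP).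
  by rewrite -X'E back.
  move=> i j ij; rewrite !mxE; have {}ij := zle _ _ ij.
  by have [zi|zi] := leP (z 0 i) 0; have [zj|zj] := leP (z 0 j) 0; lra.
apply: (@eigenframe_of_noninc _ _ (\row_i Num.min (z 0 i) 0) PP).
  by rewrite -S'E back.
move=> i j ij; rewrite !mxE; have {}ij := zle _ _ ij.
by have [zi|zi] := leP (z 0 i) 0; have [zj|zj] := leP (z 0 j) 0; lra.
Qed.

End Frames.

(** * The sets Upsilon as conditions on kernels *)

Section Vanish.
Context {R : realType} {n : nat}.
Implicit Types X S W : symM R n.

Lemma subcolsE k (J : {set 'I_n}) (M : 'M[R]_(k, n)) :
  subcols J M = M *m subcols J 1%:M.
Proof.
apply/matrixP => i j; rewrite !mxE (bigD1 (enum_val j)) //= !mxE eqxx mulr1.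
by rewrite big1 ?addr0 // => l lj; rewrite !mxE (negPf lj) mulr0.
Qed.

Lemma subcols_proj (J : {set 'I_n}) (i j : 'I_n) :
  (subcols J (1%:M : 'M[R]_n) *m (subcols J 1%:M)^T) i j = ((i == j) && (i \in J))%:R.
Proof.
rewrite mxE; have [iJ|iJ] := boolP (i \in J); last first.
  rewrite andbF big1 // => k _; rewrite !mxE (_ : i == enum_val k = false) ?mul0r //.
  by apply: contraNF iJ => /eqP ->; exact: enum_valP.
rewrite andbT (bigD1 (enum_rank_in iJ i)) //= !mxE enum_rankK_in // eqxx mul1r.
rewrite big1 ?addr0 1?eq_sym // => k ki.
rewrite !mxE (_ : i == enum_val k = false) ?mul0r //.
by apply: contraNF ki => /eqP ik; apply/eqP/enum_val_inj; rewrite enum_rankK_in.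
Qed.

Lemma subcols1_orth (J : {set 'I_n}) :
  (subcols J (1%:M : 'M[R]_n))^T *m subcols J 1%:M = 1%:M.
Proof.
rewrite -subcolsE; apply/matrixP => i j; rewrite !mxE.
by rewrite (inj_eq enum_val_inj) eq_sym.
Qed.

Lemma gamma_columns_vanishW X S P W :
  (forall i j, j \in idx_gamma S -> (W *m P) i j = 0) ->
  gamma_columns_vanish X S P W.
Proof.
move=> WP0; rewrite /gamma_columns_vanish -mulmxA (_ : W *m _ = 0) ?mulmx0 //.
rewrite subcolsE mulmxA -subcolsE; apply/matrixP => i j.
by rewrite [LHS]mxE [RHS]mxE WP0 // enum_valP.
Qed.

Lemma mulmx_frame_eq0 W S P : eigenframes S P ->
  W *m S = 0 <-> forall i j, lambda S 0 j != 0 -> (W *m P) i j = 0.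
Proof.
move=> [PP SE]; rewrite [X in W *m X]SE; split=> [WS i j Sj|h].
  have : W *m P *m diag_mx (lambda S) = 0.
    by move/(congr1 (mulmx^~ P)): WS; rewrite mul0mx -!mulmxA PP mulmx1.
  move/matrixP/(_ i j); rewrite mul_mx_diag [LHS]mxE [RHS]mxE => /eqP.
  by rewrite mulf_eq0 (negPf Sj) orbF => /eqP.
rewrite !mulmxA (_ : W *m P *m diag_mx _ = 0) ?mul0mx //.
apply/matrixP => i j; rewrite mul_mx_diag [LHS]mxE [RHS]mxE.
by have [->|Sj] := eqVneq (lambda S 0 j) 0; rewrite ?mulr0 // h // mul0r.
Qed.

Lemma lambda_normal_le0 X S i : psd X -> normal_cone symip psd X S -> lambda S 0 i <= 0.
Proof.
move=> Xp /(normal_cone_psdP _ Xp)[Sn _].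
have [P [PP SE]] := eigenframe_exists S.
rewrite (diag_mxE _ i PP) -SE -oppr_ge0 -mxipNr -mulNmx.
exact: ((psdP _).1 Sn).
Qed.

Lemma idx_gammaE X S i : psd X -> normal_cone symip psd X S ->
  (i \in idx_gamma S) = (lambda S 0 i != 0).
Proof.
by move=> Xp SN; rewrite inE lt_neqAle (lambda_normal_le0 i Xp SN) andbT.
Qed.

(** The columns of [P] indexed by alpha, beta and gamma exhaust the orthogonal matrix
[P], so the condition says [W P_gamma = 0], and [P_gamma] spans the range of [S]. *)
Lemma gamma_columns_vanishP X S P W : psd X -> normal_cone symip psd X S ->
  (eigenframes X `&` eigenframes S) P ->
  gamma_columns_vanish X S P W <-> W *m S = 0.
Proof.
move=> Xp SN [_ PS]; split=> [|/(mulmx_frame_eq0 _ PS) h]; last first.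
  apply: gamma_columns_vanishW => i j; rewrite (idx_gammaE _ Xp SN); exact: h.
rewrite /gamma_columns_vanish !tr_row_mx !mul_col_mx => h.
have := congr1 usubmx h; rewrite col_mxKu => h1.
have := congr1 dsubmx h; rewrite col_mxKd raddf0 => hc.
have := congr1 usubmx h1; rewrite col_mxKu !raddf0 => ha.
have := congr1 dsubmx h1; rewrite col_mxKd !raddf0 => hb {h h1}.
have ent (J : {set 'I_n}) i j : i \in J -> j \in idx_gamma S ->
    (subcols J P)^T *m W *m subcols (idx_gamma S) P = 0 -> (P^T *m W *m P) i j = 0.
  move=> iJ jG /matrixP/(_ (enum_rank_in iJ i) (enum_rank_in jG j)).
  rewrite [RHS]mxE => <-; rewrite !mxE; apply: eq_bigr => k _.
  rewrite !mxE enum_rankK_in //; congr (_ * _); apply: eq_bigr => l _.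
  by rewrite !mxE enum_rankK_in.
have PWP i j : j \in idx_gamma S -> (P^T *m W *m P) i j = 0.
  move=> jG; have := lambda_psd_ge0 i Xp; rewrite le_eqVlt => /orP[/eqP Xi|Xi].
    have [Si|Si] := eqVneq (lambda S 0 i) 0.
      by apply: (ent (idx_beta X S)); rewrite // inE -Xi Si eqxx.
    by apply: (ent (idx_gamma S)); rewrite // (idx_gammaE _ Xp SN).
  by apply: (ent (idx_alpha X)); rewrite // inE.
apply/(mulmx_frame_eq0 _ PS) => i j Sj.
rewrite -[W *m P]mul1mx -(mulmx1C PS.1) -mulmxA mxE big1 // => k _.
by rewrite mulmxA PWP ?mulr0 // (idx_gammaE _ Xp SN).
Qed.

Lemma Upsilon_tildeP X S W : psd X -> normal_cone symip psd X S ->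
  Upsilon_tilde X S W <-> W *m S = 0.
Proof.
move=> Xp SN; split=> [[P [PXS]]|WS]; first by move/(gamma_columns_vanishP _ Xp SN PXS).
have [P PXS] := common_eigenframe Xp SN.
by exists P; split=> //; apply/(gamma_columns_vanishP _ Xp SN PXS).
Qed.

(** With [E] the inclusion of the nonzero coordinates, [X] factors through the
invertible diagonal matrix of its nonzero eigenvalues, and compressing [X] by
[P *m E] gives this matrix back. *)
Lemma rank_frame X P : eigenframes X P ->
  \rank (X : 'M[R]_n) = #|[set i | lambda X 0 i != 0]%SET|.
Proof.
move=> [PP XE]; set J := [set i | _]%SET; set d := lambda X in XE J *.
pose E : 'M[R]_(n, #|J|) := subcols J 1%:M.
pose dJ : 'rV[R]_#|J| := \row_i d 0 (enum_val i).
have DE : diag_mx d *m E = E *m diag_mx dJ.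
  apply/matrixP => i j; rewrite mul_diag_mx mul_mx_diag !mxE.
  by have [->|_] := eqVneq i (enum_val j); rewrite ?mulr1n ?mulr0n ?mulr0 ?mul0r // mulrC.
have EE : E^T *m E = 1%:M.
  exact: subcols1_orth.
have XPE : X *m (P *m E) = (P *m E) *m diag_mx dJ.
  by rewrite XE -!mulmxA (mulmxA P^T) PP mul1mx DE.
have EPX : (P *m E)^T *m (X *m (P *m E)) = diag_mx dJ.
  by rewrite XPE trmx_mul -!mulmxA (mulmxA P^T) PP mul1mx mulmxA EE mul1mx.
have rdJ : \rank (diag_mx dJ) = #|J|.
  apply: mxrank_unit; rewrite unitmxE det_diag unitfE; apply/prodf_neq0 => i _.
  by rewrite mxE; have := enum_valP i; rewrite inE.
have XF : X = P *m E *m diag_mx dJ *m (P *m E)^T :> 'M_n.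
  have DEE : diag_mx d *m (E *m E^T) = diag_mx d.
    apply/matrixP => i j; rewrite mul_diag_mx [LHS]mxE [RHS]mxE /E subcols_proj inE.
    have [->|d0] := eqVneq (d 0 i) 0; first by rewrite mul0r mul0rn.
    by rewrite andbT mulr_natr.
  by rewrite -[P *m E *m _]mulmxA -DE trmx_mul -!mulmxA (mulmxA E) (mulmxA (diag_mx d)) DEE mulmxA.
apply/eqP; rewrite eqn_leq; apply/andP; split.
  rewrite XF -!mulmxA (leq_trans (mxrankM_maxr _ _)) // (leq_trans (mxrankM_maxl _ _)) //.
  exact: rank_leq_col.
by rewrite -rdJ -EPX (leq_trans (mxrankM_maxr _ _)) // mxrankM_maxl.
Qed.

End Vanish.

(** * Upsilon and multipliers of large rank *)

Section UpsilonRank.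
Context {R : realType} {n : nat}.
Implicit Types X S W : symM R n.

(** As eigenvalues are sorted, both index sets are final segments of ['I_n], and final
segments are nested according to their cardinals. *)
Lemma idx_gamma_mono X S S' : psd X -> normal_cone symip psd X S ->
  normal_cone symip psd X S' -> (\rank (S : 'M[R]_n) <= \rank (S' : 'M[R]_n))%N ->
  idx_gamma S \subset idx_gamma S'.
Proof.
move=> Xp SN SN'.
have [P PS] := eigenframe_exists S; have [P' PS'] := eigenframe_exists S'.
rewrite (rank_frame PS) (rank_frame PS').
have gE (T : symM R n) : normal_cone symip psd X T ->
    [set i | lambda T 0 i != 0]%SET = idx_gamma T.
  by move=> TN; apply/setP => i; rewrite (idx_gammaE _ Xp TN) inE.
rewrite (gE _ SN) (gE _ SN') => le_card; apply/fintype.subsetP => i iS; apply: contraLR le_card => iS'.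
rewrite -ltnNge; apply: proper_card; apply/properP; split; last by exists i.
apply/fintype.subsetP => j jS'; have ij : (i <= j)%N.
  rewrite leqNgt; apply: contraNN iS' => /ltnW ji.
  by move: jS'; rewrite !inE; apply: le_lt_trans; exact: lambda_noninc.
by move: iS; rewrite !inE; apply: le_lt_trans; exact: lambda_noninc.
Qed.

Lemma distinct_eigs_uniq X : uniq (distinct_eigs X).
Proof.
by rewrite /distinct_eigs rcons_uniq undup_uniq andbT mem_undup mem_filter ltxx.
Qed.

Lemma lambda_mem_distinct X i : psd X -> lambda X 0 i \in distinct_eigs X.
Proof.
move=> Xp; rewrite /distinct_eigs mem_rcons in_cons.
have := lambda_psd_ge0 i Xp; rewrite le_eqVlt eq_sym => /orP[->//|Xi].
rewrite mem_undup mem_filter Xi /=; apply/orP; right.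
move: Xi; rewrite mxE; have [ii|ii] := ltnP i (size (eigs X)); first by rewrite mem_nth.
by rewrite nth_default // ltxx.
Qed.

(** [P^T *m P'] commutes with the diagonal matrix of the eigenvalues. *)
Lemma frames_commute X P P' : eigenframes X P -> eigenframes X P' ->
  forall i j, lambda X 0 i != lambda X 0 j -> (P^T *m P') i j = 0.
Proof.
move=> [PP XE] [PP' XE'] i j Xij.
have : diag_mx (lambda X) *m (P^T *m P') = (P^T *m P') *m diag_mx (lambda X).
  have e1 : P^T *m X = diag_mx (lambda X) *m P^T.
    by rewrite {1}XE !mulmxA PP mul1mx.
  have e2 : X *m P' = P' *m diag_mx (lambda X).
    by rewrite {1}XE' -!mulmxA PP' mulmx1.
  by rewrite mulmxA -e1 -mulmxA e2 mulmxA.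
move/matrixP/(_ i j); rewrite mul_diag_mx mul_mx_diag [LHS]mxE [RHS]mxE.
rewrite mulrC => /eqP; rewrite -subr_eq0 -mulrBr mulf_eq0 subr_eq0 (negPf Xij) orbF.
by move/eqP.
Qed.

(** The diagonal blocks of [T] on the eigenvalue classes of [X]. *)
Definition frame_blocks X (T : 'M[R]_n) (j : 'I_(size (distinct_eigs X))) :
    'M[R]_#|alpha_class j| :=
  (subcols (alpha_class j) 1%:M)^T *m T *m subcols (alpha_class j) 1%:M.
Arguments frame_blocks : clear implicits.

Lemma subcols_projE (J : {set 'I_n}) :
  subcols J (1%:M : 'M[R]_n) *m (subcols J 1%:M)^T = diag_mx (\row_i (i \in J)%:R).
Proof.
apply/matrixP => i j; rewrite subcols_proj [RHS]mxE mxE.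
by case: eqP; case: (i \in J).
Qed.

Lemma blkdiag_frame_blocks X (T : 'M[R]_n) : psd X ->
  (forall i j, lambda X 0 i != lambda X 0 j -> T i j = 0) ->
  blkdiag (frame_blocks X T) = T.
Proof.
move=> Xp T0; apply/matrixP => i j; rewrite summxE.
have iX := lambda_mem_distinct i Xp; have := iX; rewrite -index_mem => ki.
pose k := Ordinal ki.
have block c : (subcols (alpha_class c) 1%:M *m frame_blocks X T c *m
    (subcols (alpha_class c) 1%:M)^T) i j =
    if (i \in alpha_class c) && (j \in alpha_class c) then T i j else 0.
  rewrite /frame_blocks !mulmxA subcols_projE -!mulmxA subcols_projE !mulmxA.
  rewrite mul_mx_diag mxE mul_diag_mx [X in X * _]mxE ![(\row__ _) _ _]mxE.
  by case: (i \in _); case: (j \in _); rewrite /= ?mulr1 ?mul1r ?mulr0 ?mul0r.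
rewrite (bigD1 k) //= block big1 => [|c ck]; last first.
  rewrite block; case: ifP => // /andP[+ _]; rewrite inE => /eqP Xi.
  move/eqP: ck; case; apply: val_inj => /=; rewrite Xi index_uniq //.
  exact: distinct_eigs_uniq.
rewrite addr0 !inE /= nth_index // eqxx /=.
by have [//|Xij] := eqVneq (lambda X 0 j); rewrite T0 // eq_sym.
Qed.

(** Take for [R] a common frame [P'] of [X] and [S']: its last columns, as many as the
rank of [S'], span the range of [S'] and are killed by [W], and they include those
indexed by the gamma set of [S].  Two frames of [X] differ by a matrix that is block
diagonal for the eigenvalue classes, which provides the matrices [Q_j]. *)
Lemma Upsilon_of_rank X S S' W : psd X -> normal_cone symip psd X S ->
  normal_cone symip psd X S' -> (\rank (S : 'M[R]_n) <= \rank (S' : 'M[R]_n))%N ->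
  W *m S' = 0 -> Upsilon X S W.
Proof.
move=> Xp SN SN' rSS' WS'.
have [P PXS] := common_eigenframe Xp SN.
have [P' [P'X P'S']] := common_eigenframe Xp SN'.
have [PX _] := PXS; have PPt := mulmx1C PX.1.
pose T := P^T *m P'.
have T0 := frames_commute PX P'X; rewrite -/T in T0.
have PT : P *m blkdiag (frame_blocks X T) = P'.
  by rewrite blkdiag_frame_blocks // mulmxA PPt mul1mx.
have TT : T^T *m T = 1%:M.
  by rewrite /T trmx_mul trmxK -mulmxA (mulmxA P) PPt mul1mx; exact: P'X.1.
exists P, (frame_blocks X T); split=> //; last 2 first.
- by rewrite PT.
- rewrite PT; apply: gamma_columns_vanishW => i j jS.
  apply/(mulmx_frame_eq0 _ P'S').1 => //.
  by rewrite -(idx_gammaE _ Xp SN'); apply: (fintype.subsetP (idx_gamma_mono Xp SN SN' rSS')).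
move=> c; rewrite /orthogonal_group /frame_blocks /=.
set E := subcols (alpha_class c) 1%:M.
have KTE : (E *m E^T) *m (T *m E) = T *m E.
  apply/matrixP => i j; rewrite subcols_projE mul_diag_mx [LHS]mxE [X in X * _]mxE.
  have [_|ic] := boolP (i \in alpha_class c); first by rewrite mul1r.
  rewrite mul0r -subcolsE mxE T0 //.
  have := enum_valP j; rewrite inE => /eqP ->.
  by move: ic; rewrite inE.
clearbody T; rewrite !trmx_mul trmxK -!mulmxA (mulmxA E) KTE (mulmxA T^T) TT mul1mx.
exact: subcols1_orth.
Qed.

End UpsilonRank.

(** * The Euclidean space of symmetric matrices *)

Section SymInnerProduct.
Context {R : realType} {n : nat}.
Implicit Types X Y Z : symM R n.

Lemma symipC X Y : symip X Y = symip Y X. Proof. exact: mxipC. Qed.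
Lemma symipDr X Y Z : symip X (Y + Z) = symip X Y + symip X Z. Proof. exact: mxipDr. Qed.
Lemma symipDl X Y Z : symip (X + Y) Z = symip X Z + symip Y Z. Proof. exact: mxipDl. Qed.
Lemma symipBr X Y Z : symip X (Y - Z) = symip X Y - symip X Z. Proof. exact: mxipBr. Qed.
Lemma symipBl X Y Z : symip (X - Y) Z = symip X Z - symip Y Z. Proof. exact: mxipBl. Qed.
Lemma symipZr c X Y : symip X (c *: Y) = c * symip X Y. Proof. exact: mxipZr. Qed.
Lemma symipZl c X Y : symip (c *: X) Y = c * symip X Y. Proof. exact: mxipZl. Qed.
Lemma symipNr X Y : symip X (- Y) = - symip X Y. Proof. exact: mxipNr. Qed.
Lemma symip0r X : symip X 0 = 0. Proof. exact: mxip0r. Qed.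
Lemma symip0l X : symip 0 X = 0. Proof. exact: mxip0l. Qed.
Lemma symip_ge0 X : 0 <= symip X X. Proof. exact: mxip_ge0. Qed.

Lemma symip_eq0 X : symip X X = 0 -> X = 0.
Proof. by move/mxip_eq0 => X0; apply: val_inj. Qed.

Lemma symip_testP X Y : (forall Z, symip X Z = symip Y Z) -> X = Y.
Proof.
move=> h; apply/eqP; rewrite -subr_eq0; apply/eqP/symip_eq0.
by rewrite symipBl h subrr.
Qed.

Definition nrm X : R := fro (X : 'M[R]_n).

Lemma enormE X : enorm symip X = nrm X. Proof. by []. Qed.
Lemma nrm_ge0 X : 0 <= nrm X. Proof. exact: fro_ge0. Qed.
Lemma nrm0 : nrm 0 = 0. Proof. exact: fro0. Qed.
Lemma nrm_gt0 X : X != 0 -> 0 < nrm X.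
Proof.
move=> X0; apply: fro_gt0; apply: contraNneq X0 => X0.
by apply/eqP/val_inj.
Qed.
Lemma sqr_nrm X : nrm X ^+ 2 = symip X X. Proof. exact: sqr_fro. Qed.
Lemma nrmD X Y : nrm (X + Y) <= nrm X + nrm Y. Proof. exact: froD. Qed.
Lemma nrmN X : nrm (- X) = nrm X. Proof. exact: froN. Qed.
Lemma nrmZ c X : nrm (c *: X) = `|c| * nrm X. Proof. exact: froZ. Qed.
Lemma nrmBC X Y : nrm (X - Y) = nrm (Y - X). Proof. exact: froB_sym. Qed.
Lemma nrmB X Y : nrm (X - Y) <= nrm X + nrm Y.
Proof. by apply: le_trans (nrmD _ _) _; rewrite nrmN. Qed.
Lemma symip_CS X Y : `|symip X Y| <= nrm X * nrm Y. Proof. exact: mxip_CS. Qed.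
Lemma symip_le X Y : symip X Y <= nrm X * nrm Y.
Proof. exact: le_trans (ler_norm _) (symip_CS X Y). Qed.
Lemma nrm_split X Y : nrm X <= nrm Y + nrm (X - Y).
Proof. by have := nrmD Y (X - Y); rewrite addrCA subrr addr0. Qed.

(** Limits are required to be symmetric matrices, which they are automatically, see
[scvg_exists]. *)
Definition scvg (Y : nat -> symM R n) Z := mcvg (fun k => Y k : 'M[R]_n) Z.

Lemma scvg_exists (Y : nat -> symM R n) c : (forall k, nrm (Y k) <= c) -> exists Z, scvg Y Z.
Proof.
move=> Yc; have [|L YL] := @mcvg_exists R _ _ (fun k => Y k : 'M[R]_n) (c ^+ 2).
  by move=> k; apply: mxip_le_fro; exact: Yc.
have Ls : L \in symmx R n.
  rewrite symmxE; apply/eqP; apply: mcvg_unique (YL).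
  have <- : (fun k => (Y k : 'M[R]_n)^T) = (fun k => Y k : 'M[R]_n).
    by apply/funext => k; rewrite symM_tr.
  exact: mcvg_tr YL.
by exists (SymM Ls).
Qed.

Implicit Types U V : nat -> symM R n.

Lemma scvg_cst Z : scvg (fun=> Z) Z. Proof. exact: mcvg_cst. Qed.
Lemma scvgN U Z : scvg U Z -> scvg (fun k => - U k) (- Z).
Proof. exact: mcvgN. Qed.
Lemma scvgB U V Z Z' : scvg U Z -> scvg V Z' -> scvg (fun k => U k - V k) (Z - Z').
Proof. exact: mcvgB. Qed.
Lemma ulim_symip U V Z Z' : scvg U Z -> scvg V Z' ->
  (fun k => symip (U k) (V k)) @ omega --> symip Z Z'.
Proof. exact: ulim_mxip. Qed.
Lemma scvg_squeeze U Z c : (forall k, nrm (U k - Z) <= c * k.+1%:R^-1) -> scvg U Z.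
Proof.
move=> h i j; suff /ulimD : (fun k => (U k - Z : symM R n) i j) @ omega --> (0 : R).
  move=> /(_ (fun=> Z i j) (Z i j) (ulim_const (fun=> erefl))); rewrite add0r.
  by under eq_fun do rewrite !mxE subrK.
apply: (@ulim0 _ _ c) => k; apply: le_trans (h k).
rewrite -(@ler_pXn2r _ 2) ?nnegrE ?normr_ge0 ?nrm_ge0 //.
by rewrite -normrX ger0_norm ?sqr_ge0 // sqr_nrm; exact: sqr_entry_le_mxip.
Qed.

Lemma scvg_psd U Z : (forall k, psd (U k)) -> scvg U Z -> psd Z.
Proof.
move=> Up UZ; apply/psdP => u.
have h := ulim_mxip (mcvg_cst u) (mcvgM UZ (mcvg_cst u)).
by apply: ulim_le (ulim_const (fun=> erefl)) h _ => k; apply: (psdP _).1.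
Qed.

(** Weierstrass, with closedness and continuity stated along [omega]. *)
Lemma minimum_attained (D : set (symM R n)) (f : symM R n -> R) (c m : R) :
  D !=set0 -> (forall Y, D Y -> nrm Y <= c) -> (forall Y, D Y -> m <= f Y) ->
  (forall U Z, (forall k, D (U k)) -> scvg U Z -> D Z) ->
  (forall U Z, scvg U Z -> (fun k => f (U k)) @ omega --> f Z) ->
  exists2 Z, D Z & forall Y, D Y -> f Z <= f Y.
Proof.
move=> [Y0 DY0] Dc fm Dcl fc; pose E := [set f Y | Y in D].
have Ei : has_inf E by split; [exists (f Y0), Y0|exists m => _ [Y DY <-]; exact: fm].
have /choice[Y HY] : forall k : nat, exists Y, D Y /\ f Y <= inf E + k.+1%:R^-1.
  move=> k; have [|_ [Y DY <-] h] := @inf_adherent R E k.+1%:R^-1 _ Ei.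
    by rewrite invr_gt0 ltr0n.
  by exists Y; split=> //; exact: ltW.
have [|Z YZ] := @scvg_exists Y c; first by move=> k; exact: Dc (HY k).1.
exists Z; first by apply: Dcl YZ => k; exact: (HY k).1.
move=> Y' DY'; apply: (@le_trans _ _ (inf E + 0)).
  apply: ulim_le (fc _ _ YZ) _ (fun k => (HY k).2).
  by apply: ulimD ulim_harmonic; exact: ulim_const.
by rewrite addr0; apply: (ge_inf Ei.2); exists Y'.
Qed.

End SymInnerProduct.
Arguments scvg_cst {R n} Z.

Lemma quad_ge0_slope (R : realType) (a c : R) :
  (forall t, 0 < t -> t <= 1 -> 0 <= t * a + t ^+ 2 * c) -> 0 <= a.
Proof.
move=> h; rewrite leNgt; apply/negP => a0.
pose d := `|c| + 1 + - a; have d0 : 0 < d by rewrite /d; have := normr_ge0 c; lra.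
pose t := - a / d; have td : t * d = - a by rewrite /t mulfVK ?gt_eqF.
have t0 : 0 < t by rewrite divr_gt0 // oppr_gt0.
have t1 : t <= 1 by rewrite ler_pdivrMr // /d; have := normr_ge0 c; lra.
have := h t t0 t1; have := ler_norm c; move: td; rewrite /d.
have : 0 <= `|c| by []. move: `|c| => e.
nra.
Qed.

(** * Slater points and Lagrange multipliers *)

Section Multipliers.
Context {R : realType} {n m : nat}.
Variables (A : {linear symM R n -> 'cV[R]_m}) (b : 'cV[R]_m).
Implicit Types (X Y Z S V W : symM R n) (y w : 'cV[R]_m).

Definition surjective_map := forall w, exists H, A H = w.

Definition strictly_feasible (eta : R) X0 :=
  [/\ 0 < eta, A X0 = b & forall u : 'cV_n, eta * mxip u u <= mxip u ((X0 : 'M[R]_n) *m u)].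

Lemma scalar_symmx (c : R) : (c%:M : 'M[R]_n) \in symmx R n.
Proof. by rewrite symmxE tr_scalar_mx. Qed.

(** The distance to an empty preimage would be infinite, while [constraint_map A b X]
is nonempty, so the right-hand side of the regularity estimate is finite. *)
Lemma regular_solvable X : metrically_regular symip (prod_ip mxip symip)
    (constraint_map A b) X (0, 0) ->
  exists2 delta : R, 0 < delta & forall z : 'cV[R]_m * symM R n,
    enorm (prod_ip mxip symip) z <= delta -> exists Y, constraint_map A b Y z.
Proof.
move=> [X0 [delta [kappa [d0 k0 reg]]]]; exists delta => // z zd.
apply: contrapT => nY.
have /reg : cball (prod_ip symip (prod_ip mxip symip)) (X, (0, 0)) delta (X, z).
  rewrite /cball /= /enorm /prod_ip /= subrr symip0l add0r.
  have -> : z.1 - 0 = z.1 by rewrite subr0.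
  have -> : z.2 - 0 = z.2 by rewrite subr0.
  exact: zd.
rewrite {1}/dist (_ : [set u | constraint_map A b u z] = set0); last first.
  by rewrite -subset0 => Y YG; apply: nY; exists Y.
rewrite image_set0 ereal_inf0 => h.
have : (kappa%:E * dist (prod_ip mxip symip) z (constraint_map A b X) <=
    kappa%:E * (enorm (prod_ip mxip symip) (z - (0, 0)))%:E)%E.
  apply: lee_wpmul2l; first by rewrite lee_fin ltW.
  by apply: ereal_inf_lbound; exists (0, 0).
by move/(le_trans h); rewrite -EFinM leye_eq.
Qed.

(** Solve the constraints for the perturbations [(t w, 0)] and [(0, eta I)]: the second
one asks for a feasible matrix above [eta I]. *)
Lemma slater_of_regularity X : metrically_regular symip (prod_ip mxip symip)
    (constraint_map A b) X (0, 0) -> A X = b ->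
  surjective_map /\ exists eta X0, strictly_feasible eta X0.
Proof.
move=> /regular_solvable[delta d0 reg] AX; split.
  move=> w; pose t := delta / (fro w + 1).
  have w0 : 0 < fro w + 1 by rewrite ltr_wpDl ?fro_ge0.
  have t0 : 0 < t by rewrite divr_gt0.
  have [|Y [k [k1 k2] [e1 e2]]] := reg (t *: w, 0).
    rewrite /enorm /prod_ip /= symip0l addr0 -/(fro (t *: w)) froZ gtr0_norm //.
    by rewrite /t mulrAC ler_pdivrMr // ler_pM2l // lerDl.
  exists (t^-1 *: (Y - X)); rewrite linearZ linearB /= AX.
  by move: e1; rewrite k1 subr0 => ->; rewrite scalerA mulVf ?scale1r ?gt_eqF.
pose I : symM R n := SymM (scalar_symmx 1).
pose eta := delta / (nrm I + 1).
have I0 : 0 < nrm I + 1 by rewrite ltr_wpDl ?nrm_ge0.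
have eta0 : 0 < eta by rewrite divr_gt0.
have [|Y [k [k1 k2] [e1 e2]]] := reg (0, eta *: I).
  rewrite /enorm /prod_ip /= mxip0l add0r -/(enorm symip _) enormE nrmZ gtr0_norm //.
  by rewrite /eta mulrAC ler_pdivrMr // ler_pM2l // lerDl.
exists eta, Y; split=> //.
  by apply/eqP; rewrite -subr_eq0; move: e1; rewrite k1 subr0 => ->.
have {}e2 : Y = k.2 + eta *: I.
  by rewrite -[LHS](subrK k.2) addrC; congr (_ + _); apply: val_inj; exact: e2.
move=> u; rewrite e2.
rewrite /= mulmxDl mxipDr -scalemxAl mul1mx mxipZr lerDr.
exact: (psdP _).1.
Qed.

Lemma mcvg_linear (U : nat -> symM R n) Z : scvg U Z -> mcvg (fun k => A (U k)) (A Z).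
Proof.
move=> UZ i j; rewrite ord1.
have E X : A X i 0 = symip (adjoint A (delta_mx i 0)) X.
  by rewrite adjointP /mxip trmx_delta -rowE /mxtrace big_ord1 mxE.
have -> : (fun k => A (U k) i 0) = fun k => symip (adjoint A (delta_mx i 0)) (U k).
  by apply/funext => k; rewrite E.
by rewrite E; apply: ulim_symip => //; exact: scvg_cst.
Qed.

(** With [A (H_i) = e_i], the coordinate [y_i] equals [<adjoint A y, H_i>], hence
converges with [adjoint A y]. *)
Lemma adjoint_range_closed (y : nat -> 'cV[R]_m) Z : surjective_map ->
  scvg (fun k => adjoint A (y k)) Z -> exists y', adjoint A y' = Z.
Proof.
move=> /choice[H AH] yZ.
pose y' : 'cV[R]_m := \col_i symip Z (H (delta_mx i 0)).
have yy' : mcvg y y'.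
  move=> i j; rewrite ord1 mxE.
  have -> : (fun k => y k i 0) = fun k => symip (adjoint A (y k)) (H (delta_mx i 0)).
    apply/funext => k; rewrite adjointP AH mxipC /mxip trmx_delta -rowE.
    by rewrite /mxtrace big_ord1 mxE.
  by apply: ulim_symip => //; exact: scvg_cst.
exists y'; apply: symip_testP => W; rewrite adjointP.
apply: ulim_unique (ulim_mxip yy' (mcvg_cst (A W))) _.
have -> : (fun k => mxip (y k) (A W)) = fun k => symip (adjoint A (y k)) W.
  by apply/funext => k; rewrite adjointP.
by apply: ulim_symip => //; exact: scvg_cst.
Qed.

Lemma slater_trace eta X0 S : strictly_feasible eta X0 -> psd (- S) ->
  eta * nrm S <= - symip S X0.
Proof.
move=> [eta0 _ hX0] Sn.
have h : psdmx ((X0 : 'M[R]_n) - eta%:M).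
  by move=> u; rewrite mulmxBl mxipBr mul_scalar_mx mxipZr subr_ge0 hX0.
have := (psdmx_trace_mul (symM_tr (- S)) ((psdP _).1 Sn) h).1.
rewrite mulmxBr raddfB /= mul_mx_scalar mxtraceZ mulNmx raddfN /= => h1.
have := psdmx_fro_le_tr (symM_tr (- S)) ((psdP _).1 Sn).
rewrite -/(nrm (- S)) nrmN => /(ler_wpM2l (ltW eta0)) /le_trans; apply.
by rewrite /symip /mxip symM_tr -subr_ge0.
Qed.

(** [<S, X> = 0] and [A X = A X0] turn [- <S, X0>] into [- <V, X0 - X>], while
[slater_trace] bounds [eta |S|] by it. *)
Lemma normal_cone_bound eta X0 X S V y : strictly_feasible eta X0 ->
  psd X -> A X = b -> normal_cone symip psd X S -> adjoint A y + S = V ->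
  eta * nrm S <= nrm V * nrm (X0 - X).
Proof.
move=> sf Xp AX SN SV; have [Sn SX] := (normal_cone_psdP _ Xp).1 SN.
apply: le_trans (slater_trace sf Sn) _; case: sf => _ AX0 _.
have -> : - symip S X0 = - symip V (X0 - X).
  by rewrite -SV symipDl adjointP linearB /= AX AX0 subrr mxip0r add0r symipBr SX subr0.
by rewrite -symipNl -(nrmN V) symip_le.
Qed.

(** The minimizer over the psd cone of [rho |A Y - b|^2 + |Y - X|^2 - 2 <V, Y - X>].
The proximal term makes the problem coercive and, as the penalty grows, forces
convergence to [X].  Only the simple constraint [psd] is left, so first-order
optimality needs derivatives along segments and no separation theorem. *)
Lemma penalty_minimizer (rho : R) X V : 0 <= rho -> psd X -> A X = b ->
  exists Y, [/\ psd Y, nrm (Y - X) <= 2 * nrm V,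
     rho * mxip (A Y - b) (A Y - b) + symip (Y - X) (Y - X) <= 2 * symip V (Y - X) &
     normal_cone symip psd Y (V - adjoint A (rho *: (A Y - b)) - (Y - X))].
Proof.
move=> rho0 Xp AX.
pose f Y := rho * mxip (A Y - b) (A Y - b) + symip (Y - X) (Y - X) - 2 * symip V (Y - X).
have fX : f X = 0.
  by rewrite /f AX !subrr mxip0l symip0l symip0r !mulr0 addr0 subrr.
have flow Y : nrm (Y - X) ^+ 2 - 2 * (nrm V * nrm (Y - X)) <= f Y.
  rewrite /f sqr_nrm; have := symip_le V (Y - X).
  have : 0 <= rho * mxip (A Y - b) (A Y - b) by rewrite mulr_ge0 // mxip_ge0.
  lra.
(* outside the ball of radius r around X, the penalized value exceeds the one at X *)
pose r := 2 * nrm V + 1.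
have r0 : 0 < r by have := nrm_ge0 V; rewrite /r; lra.
pose D := [set Y | psd Y /\ nrm (Y - X) <= r].
have [|Y [Yp YX]|Y [Yp YX]|U Z UD UZ|U Z UZ|Y [Yp YX] Ymin] :=
    @minimum_attained R n D f (nrm X + r) (- (2 * (nrm V * r))).
- by exists X; split=> //; rewrite subrr nrm0 ltW.
- by apply: le_trans (nrm_split Y X) _; rewrite lerD2l.
- apply: le_trans (flow Y).
  have : nrm V * nrm (Y - X) <= nrm V * r by rewrite ler_wpM2l ?nrm_ge0.
  have := sqr_ge0 (nrm (Y - X)); lra.
- split; first by apply: scvg_psd UZ => k; exact: (UD k).1.
  rewrite -(@ler_pXn2r _ 2) ?nnegrE ?nrm_ge0 ?(ltW r0) // sqr_nrm.
  have UX := scvgB UZ (scvg_cst X).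
  apply: ulim_le_const (ulim_symip UX UX) _ => k.
  by rewrite -sqr_nrm ler_pXn2r ?nnegrE ?nrm_ge0 ?(ltW r0) // (UD k).2.
- have UX := scvgB UZ (scvg_cst X).
  have UA := mcvgB (mcvg_linear UZ) (mcvg_cst b).
  apply: ulimB; last by apply: ulimM; [exact: ulim_const|exact: (ulim_symip (scvg_cst _) UX)].
  apply: (ulimD _ (ulim_symip UX UX)).
  by apply: ulimM; [exact: ulim_const|exact: (ulim_mxip UA UA)].
have fY0 : f Y <= 0.
  have : f Y <= f X by apply: Ymin; split; [exact: Xp|rewrite subrr nrm0 ltW].
  by rewrite fX.
have fE Z : f Z = rho * mxip (A Z - b) (A Z - b) + symip (Z - X) (Z - X)
  - 2 * symip V (Z - X) by [].
have rE : r = 2 * nrm V + 1 by [].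
clearbody f r.
have Ymin' Y' : psd Y' -> f Y <= f Y'.
  move=> Y'p; have [h|h] := leP (nrm (Y' - X)) r; first exact: Ymin.
  apply: le_trans fY0 _; apply: le_trans (flow Y').
  move: h (nrm_ge0 V) (nrm_ge0 (Y' - X)); rewrite rE.
  by move: (nrm V) (nrm _) => v a; clear; nra.
exists Y; split=> //.
- rewrite leNgt; apply/negP => h.
  have := le_trans (flow Y) fY0; have := nrm_ge0 V => V0.
  have : 0 < nrm (Y - X) * (nrm (Y - X) - 2 * nrm V).
    by rewrite mulr_gt0 ?subr_gt0 // (le_lt_trans _ h) // mulr_ge0.
  lra.
- by move: fY0; rewrite fE; lra.
move=> Y' Y'p; rewrite -oppr_ge0; set d := Y' - Y.
apply: (@quad_ge0_slope _ _ ((rho * mxip (A d) (A d) + symip d d) / 2)) => t t0 t1.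
have Ytp : psd (Y + t *: d).
  have -> : Y + t *: d = (1 - t) *: Y + t *: Y'.
    by rewrite /d scalerBr scalerBl scale1r addrA addrAC.
  apply/psdP => u; rewrite /= mulmxDl -!scalemxAl mxipDr !mxipZr.
  by rewrite addr_ge0 ?mulr_ge0 ?subr_ge0 ?(ltW t0) //; exact: (psdP _).1.
have := Ymin' _ Ytp; rewrite !fE.
have -> : Y + t *: d - X = (Y - X) + t *: d by rewrite addrAC.
have -> : A (Y + t *: d) - b = (A Y - b) + t *: A d by rewrite linearD linearZ /= addrAC.
have -> : symip (V - adjoint A (rho *: (A Y - b)) - (Y - X)) d =
    symip V d - rho * mxip (A Y - b) (A d) - symip (Y - X) d.
  by rewrite !symipBl adjointP mxipZl.
clear D Ymin Ymin' Ytp fE flow; clearbody d.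
move: (A Y - b) (A d) => e e'; move: (Y - X) => g.
rewrite !(mxipDl, mxipDr, mxipZl, mxipZr, symipDl, symipDr, symipZl, symipZr).
rewrite (mxipC e' e) (symipC d g) => h; lra.
Qed.

(** The penalized problems have approximate multipliers [y k] and [S k].  The Slater
point bounds [S k], so that a limit exists, and the penalized minimizers converge to
[X] because [X] minimizes [- <V, .>] on the feasible set. *)
Lemma multiplier_exists eta X0 X V : surjective_map -> strictly_feasible eta X0 ->
  psd X -> A X = b -> normal_cone symip (feasible A b) X V ->
  exists y S, normal_cone symip psd X S /\ adjoint A y + S = V.
Proof.
move=> surj sf Xp AX VN; have [eta0 AX0 _] := sf.
have /choice[Y HY] : forall k : nat, exists Y,
  [/\ psd Y, nrm (Y - X) <= 2 * nrm V,
     k.+1%:R * mxip (A Y - b) (A Y - b) + symip (Y - X) (Y - X) <= 2 * symip V (Y - X) &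
     normal_cone symip psd Y (V - adjoint A (k.+1%:R *: (A Y - b)) - (Y - X))].
  by move=> k; apply: penalty_minimizer.
pose y k := k.+1%:R *: (A (Y k) - b).
pose S k := V - adjoint A (y k) - (Y k - X).
pose c := 2 * (nrm V * (2 * nrm V)).
have Yp k : psd (Y k) by have [] := HY k.
have Yc k : nrm (Y k - X) <= 2 * nrm V by have [] := HY k.
have SN k : normal_cone symip psd (Y k) (S k) by have [] := HY k.
have Vc k : 2 * symip V (Y k - X) <= c.
  rewrite ler_pM2l //; apply: le_trans (symip_le _ _) _.
  by rewrite ler_wpM2l ?nrm_ge0.
have resid k : k.+1%:R * mxip (A (Y k) - b) (A (Y k) - b) <= c.
  have [_ _ + _] := HY k; have := symip_ge0 (Y k - X); have := Vc k; lra.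
have [|Z YZ] := @scvg_exists _ _ Y (nrm X + 2 * nrm V).
  by move=> k; apply: le_trans (nrm_split _ X) _; rewrite lerD2l.
have Zp : psd Z by exact: scvg_psd YZ.
have AZ : A Z = b.
  apply/eqP; rewrite -subr_eq0; apply/eqP/mxip_eq0.
  have h := mcvgB (mcvg_linear YZ) (mcvg_cst b).
  apply: ulim_unique (ulim_mxip h h) _; apply: (@ulim0 _ _ c) => k.
  by rewrite ger0_norm ?mxip_ge0 // ler_pdivlMr ?ltr0n // mulrC resid.
have ZX : Z = X.
  have h := scvgB YZ (scvg_cst X).
  have : symip (Z - X) (Z - X) <= 2 * symip V (Z - X).
    apply: (@ulim_le _ (fun k => symip (Y k - X) (Y k - X)) (fun k => 2 * symip V (Y k - X))).
    - exact: (ulim_symip h h).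
    - by apply: ulimM; [exact: ulim_const|exact: (ulim_symip (scvg_cst V) h)].
    - move=> k; have [_ _ + _] := HY k.
      have : 0 <= k.+1%:R * mxip (A (Y k) - b) (A (Y k) - b) by rewrite mulr_ge0 ?mxip_ge0.
      lra.
  have : symip V (Z - X) <= 0 by apply: VN.
  move=> h1 h2; apply/eqP; rewrite -subr_eq0; apply/eqP/symip_eq0.
  by apply/le_anti; rewrite symip_ge0 andbT; lra.
have Sc k : nrm (S k) <= (nrm V * (nrm X0 + nrm X + 2 * nrm V) +
    2 * nrm V * (nrm X0 + nrm X + 2 * nrm V)) / eta.
  rewrite ler_pdivlMr // mulrC.
  have [Sn SY] := (normal_cone_psdP _ (Yp k)).1 (SN k).
  apply: le_trans (slater_trace sf Sn) _.
  have d0 : nrm (X0 - Y k) <= nrm X0 + nrm X + 2 * nrm V.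
    rewrite -[X0 - Y k](_ : X0 - X - (Y k - X) = _); last first.
      by rewrite opprB addrA subrK.
    apply: le_trans (nrmB _ _) _; apply: lerD (Yc k); exact: nrmB.
  have -> : - symip (S k) X0 = - symip V (X0 - Y k) + symip (Y k - X) (X0 - Y k)
      - k.+1%:R * mxip (A (Y k) - b) (A (Y k) - b).
    have -> : symip (S k) X0 = symip (S k) (X0 - Y k) by rewrite symipBr SY subr0.
    have AXY : A (X0 - Y k) = - (A (Y k) - b) by rewrite linearB /= AX0 opprB.
    by rewrite /S !symipBl adjointP AXY /y mxipZl mxipNr; ring.
  rewrite lerBlDr ler_wpDr ?mulr_ge0 ?mxip_ge0 //; apply: lerD.
    rewrite -symipNl; apply: le_trans (symip_le _ _) _.
    by rewrite nrmN ler_wpM2l ?nrm_ge0.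
  apply: le_trans (symip_le _ _) _.
  by apply: ler_pM; rewrite ?nrm_ge0.
have [T ST] := scvg_exists Sc.
have Tn : psd (- T).
  apply: scvg_psd (scvgN ST) => k.
  by have [] := (normal_cone_psdP _ (Yp k)).1 (SN k).
have TX : symip T X = 0.
  rewrite -ZX; apply: ulim_unique (ulim_symip ST YZ) _; apply: ulim_const => k.
  by have [] := (normal_cone_psdP _ (Yp k)).1 (SN k).
have [|y' y'E] := @adjoint_range_closed y (V - T) surj.
  have -> : (fun k => adjoint A (y k)) = (fun k => V - S k - (Y k - X)).
    by apply/funext => k; apply: symip_testP => W; rewrite /S !symipBl; ring.
  have := scvgB (scvgB (scvg_cst V) ST) (scvgB YZ (scvg_cst X)).
  by rewrite ZX subrr subr0.
exists y', T; rewrite y'E subrK; split=> //; exact/(normal_cone_psdP _ Xp).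
Qed.

End Multipliers.

(** * Growth and tilt stability *)

Section Tilt.
Context {R : realType} {n m : nat}.
Variables (A : {linear symM R n -> 'cV[R]_m}) (b : 'cV[R]_m) (C Xs : symM R n).
Implicit Types (X Y Z S V W : symM R n) (y w : 'cV[R]_m).

(** The extended-valued function in the definition of [sdp_tilt_stable]. *)
Definition objective X : \bar R := ((symip C X)%:E + set_indicator (feasible A b) X)%E.

Lemma objective_feasible X : feasible A b X -> objective X = (symip C X)%:E.
Proof. by move=> XG; rewrite /objective /set_indicator; case: asboolP => // _; rewrite adde0. Qed.

Lemma objective_infeasible X : ~ feasible A b X -> objective X = +oo%E.
Proof. by move=> XG; rewrite /objective /set_indicator; case: asboolP. Qed.

Lemma tilt_argminP delta V X : 0 <= delta -> feasible A b Xs ->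
  tilt_argmin symip objective Xs delta V X <->
  [/\ feasible A b X, nrm (X - Xs) <= delta &
      forall Y, feasible A b Y -> nrm (Y - Xs) <= delta ->
        symip (C - V) X <= symip (C - V) Y].
Proof.
move=> d0 XsG; have val Y : feasible A b Y ->
    (objective Y - objective Xs - (symip V (Y - Xs))%:E =
     (symip (C - V) Y - symip (C - V) Xs)%:E)%E.
  move=> YG; rewrite !objective_feasible //; congr (_%:E).
  rewrite symipBr !symipBl; ring.
have ninf Y : ~ feasible A b Y ->
    (objective Y - objective Xs - (symip V (Y - Xs))%:E = +oo)%E.
  by move=> YG; rewrite objective_infeasible // objective_feasible.
split=> [[XB Xmin]|[XG XB Xmin]].
  have XG : feasible A b X.
    apply: contrapT => XG.
    have : cball symip Xs delta Xs by rewrite /cball /= subrr enormE nrm0.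
    by move/Xmin; rewrite ninf // val // leye_eq.
  split=> // Y YG YB; have /Xmin : cball symip Xs delta Y by [].
  by rewrite !val // lee_fin lerD2r.
split; first exact: XB.
move=> Y YB; have [YG|YG] := pselect (feasible A b Y).
  by rewrite !val // lee_fin lerD2r; exact: Xmin.
by rewrite (ninf Y) // leey.
Qed.

Lemma normal_cone_minimizer X V :
  normal_cone symip (feasible A b) X (V - C) <->
  forall Y, feasible A b Y -> symip (C - V) X <= symip (C - V) Y.
Proof.
have E Y : (symip (V - C) (Y - X) <= 0) = (symip (C - V) X <= symip (C - V) Y).
  by rewrite -[V - C]opprB symipNl oppr_le0 symipBr subr_ge0.
by split=> h Y YG; [rewrite -E|rewrite E]; exact: h.
Qed.

Lemma feasible_segment X Y t : 0 <= t -> t <= 1 -> feasible A b X -> feasible A b Y ->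
  feasible A b (X + t *: (Y - X)).
Proof.
move=> t0 t1 [Xp AX] [Yp AY]; split; last first.
  by rewrite linearD linearZ linearB /= AX AY subrr scaler0 addr0.
have -> : X + t *: (Y - X) = (1 - t) *: X + t *: Y.
  by rewrite scalerBr scalerBl scale1r addrA addrAC.
apply/psdP => u; rewrite /= mulmxDl -!scalemxAl mxipDr !mxipZr.
by rewrite addr_ge0 ?mulr_ge0 ?subr_ge0 //; exact: (psdP _).1.
Qed.

(** [X] ranges over the minimizers of the objective tilted by [V]. *)
Definition uniform_growth (kappa delta : R) := forall V X Y,
  nrm V <= delta -> feasible A b X -> feasible A b Y ->
  nrm (X - Xs) <= delta -> nrm (Y - Xs) <= delta ->
  normal_cone symip (feasible A b) X (V - C) ->
  kappa * nrm (Y - X) ^+ 2 <= symip (C - V) (Y - X).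

(** Growth at [Xs] for the zero tilt keeps the local minimizers of small tilts in the
interior of the ball; by convexity they are then global ones, to which the growth
applies.  Adding the growth inequalities of two tilted minimizers, each tested at the
other one, gives uniqueness and Lipschitz continuity. *)
Lemma tilt_stable_of_growth kappa delta : sdp_optimal A b C Xs ->
  0 < kappa -> 0 < delta -> uniform_growth kappa delta -> sdp_tilt_stable A b C Xs.
Proof.
move=> [XsG Xsmin] k0 d0 gr.
have tP := fun V X => tilt_argminP V X (ltW d0) XsG.
have lt2 : kappa * (delta / 2) > 0 by rewrite !mulr_gt0 ?invr_gt0.
pose eps := Num.min delta (kappa * (delta / 2)).
have eps0 : 0 < eps by rewrite /eps lt_min d0.
have XsB : nrm (Xs - Xs) <= delta by rewrite subrr nrm0 ltW.
have Cn : normal_cone symip (feasible A b) Xs (0 - C).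
  by apply/normal_cone_minimizer => Y YG; rewrite subr0; exact: Xsmin.
have interior V X : nrm V <= eps -> tilt_argmin symip objective Xs delta V X ->
    normal_cone symip (feasible A b) X (V - C).
  rewrite le_min => /andP[Vd Vk] /tP[XG XB Xmin].
  have Xd : nrm (X - Xs) <= delta / 2.
    have h1 := gr 0 Xs X; rewrite nrm0 subr0 in h1.
    have {}h1 := h1 (ltW d0) XsG XG XsB XB Cn.
    have h2 := Xmin _ XsG XsB; have h3 := symip_le V (X - Xs).
    have h4 : kappa * nrm (X - Xs) ^+ 2 <= nrm V * nrm (X - Xs).
      by move: h1 h2 h3; rewrite !symipBr !symipBl; clear; lra.
    rewrite leNgt; apply/negP => h5.
    have a0 : 0 < nrm (X - Xs) by apply: lt_trans h5; rewrite divr_gt0.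
    have : kappa * nrm (X - Xs) <= nrm V by rewrite -(ler_pM2r a0) -mulrA -expr2.
    by rewrite leNgt (le_lt_trans Vk) // ltr_pM2l.
  apply/normal_cone_minimizer => Y YG.
  have s0 := nrm_ge0 (Y - X).
  have q0 : 0 < nrm (Y - X) + delta / 2 by rewrite ltr_wpDl // divr_gt0.
  pose t := (delta / 2) / (nrm (Y - X) + delta / 2).
  have t0 : 0 < t by rewrite !divr_gt0.
  have t1 : t <= 1 by rewrite ler_pdivrMr // mul1r lerDr.
  have : symip (C - V) X <= symip (C - V) (X + t *: (Y - X)).
    apply: Xmin; first exact: feasible_segment (ltW t0) t1 XG YG.
    rewrite addrAC; apply: le_trans (nrmD _ _) _.
    rewrite nrmZ gtr0_norm //.
    have : t * nrm (Y - X) <= delta / 2.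
      by rewrite /t mulrAC ler_pdivrMr // ler_pM2l ?divr_gt0 // lerDl ltW // divr_gt0.
    by move: Xd; clear; lra.
  by rewrite symipDr lerDl symipZr pmulr_rge0 // symipBr subr_ge0.
have lip V V' X X' : nrm V <= eps -> nrm V' <= eps ->
    tilt_argmin symip objective Xs delta V X ->
    tilt_argmin symip objective Xs delta V' X' ->
    nrm (X - X') <= kappa^-1 * nrm (V - V').
  move=> Ve Ve' XM XM'.
  have N := interior _ _ Ve XM; have N' := interior _ _ Ve' XM'.
  have [XG XB _] := (tP _ _).1 XM; have [XG' XB' _] := (tP _ _).1 XM'.
  have Vd : nrm V <= delta by move: Ve; rewrite le_min => /andP[].
  have Vd' : nrm V' <= delta by move: Ve'; rewrite le_min => /andP[].
  have h1 := gr _ _ _ Vd XG XG' XB XB' N.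
  have h2 := gr _ _ _ Vd' XG' XG XB' XB N'.
  have h3 := symip_le (V - V') (X - X').
  rewrite mulrC ler_pdivlMr // mulrC.
  have [a0|a0] := eqVneq (nrm (X - X')) 0; first by rewrite a0 mulr0 nrm_ge0.
  have ap : 0 < nrm (X - X') by rewrite lt_def a0 nrm_ge0.
  rewrite -(ler_pM2r ap); rewrite (nrmBC X' X) in h1.
  have : symip (C - V) (X' - X) + symip (C - V') (X - X') = symip (V - V') (X - X').
    by rewrite !symipBr !symipBl; ring.
  have : 0 <= kappa * nrm (X - X') ^+ 2 by rewrite mulr_ge0 ?sqr_ge0 ?(ltW k0).
  move: h1 h2 h3; rewrite expr2; clear; lra.
have exM V : nrm V <= eps -> exists X, tilt_argmin symip objective Xs delta V X.
  move=> _; pose D := [set X | feasible A b X /\ nrm (X - Xs) <= delta].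
  have Dc X : D X -> nrm X <= nrm Xs + delta.
    by move=> [_ XB]; apply: le_trans (nrm_split _ Xs) _; rewrite lerD2l.
  have [|X DX|U Z UD UZ|U Z UZ|X [XG XB] Xmin] :=
    @minimum_attained R n D (symip (C - V)) (nrm Xs + delta)
      (- (nrm (C - V) * (nrm Xs + delta))) _ Dc.
  - by exists Xs.
  - have := ler_norm (- symip (C - V) X); rewrite normrN.
    have := symip_CS (C - V) X.
    have : nrm (C - V) * nrm X <= nrm (C - V) * (nrm Xs + delta).
      by rewrite ler_wpM2l ?nrm_ge0 // Dc.
    lra.
  - split; [split|].
    + by apply: scvg_psd UZ => k; exact: (UD k).1.1.
    + apply: mcvg_unique (mcvg_linear UZ) _.
      by move=> i j; apply: ulim_const => k; rewrite (UD k).1.2.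
    + apply: (fro_le (ltW d0)).
      have UX := scvgB UZ (scvg_cst Xs).
      apply: ulim_le_const (ulim_symip UX UX) _ => k.
      exact: (mxip_le_fro (UD k).2).
  - exact: (ulim_symip (scvg_cst _) UZ).
  - by exists X; apply/tP; split=> // Y YG YB; apply: Xmin.
have cb V : cball symip 0 eps V -> nrm V <= eps by rewrite /cball /= subr0.
have uniq V X X' : nrm V <= eps -> tilt_argmin symip objective Xs delta V X ->
    tilt_argmin symip objective Xs delta V X' -> X = X'.
  move=> Ve XM XM'; apply/eqP; rewrite -subr_eq0; apply/eqP/symip_eq0.
  have := lip _ _ _ _ Ve Ve XM XM'; rewrite subrr nrm0 mulr0 => h.
  have /le_anti h0 : nrm (X - X') <= 0 <= nrm (X - X') by rewrite h nrm_ge0.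
  by rewrite -sqr_nrm h0 expr0n.
split.
- split; last by exists Xs; rewrite -/(objective Xs) objective_feasible.
  move=> X; rewrite -/(objective X); have [XG|XG] := pselect (feasible A b X).
    by rewrite objective_feasible.
  by rewrite objective_infeasible.
- by rewrite -/(objective Xs) objective_feasible.
exists delta => //; split.
  exists eps => //; split.
    move=> V /cb Ve; have [X XM] := exM V Ve; exists X.
    apply/seteqP; split=> [X' /= X'M|X' ->//].
    exact: uniq Ve X'M XM.
  exists kappa^-1 => V V' X X' /cb Ve /cb Ve'; exact: lip.
have M0 : tilt_argmin symip objective Xs delta 0 Xs.
  by apply/tP; split=> // Y YG _; rewrite subr0; exact: Xsmin.
have e0 : nrm (0 : symM R n) <= eps by rewrite nrm0 ltW.
by apply/seteqP; split=> [X' /= X'M|X' ->//]; exact: uniq e0 X'M M0.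
Qed.

(** The compactness argument for sufficiency, by contradiction along sequences that
violate the growth with constants [1 / (k + 1)]. *)
Lemma growth_of_sharp_multipliers eta X0 : sdp_optimal A b C Xs ->
  surjective_map A -> strictly_feasible A b eta X0 ->
  (forall y S W, multipliers A b Xs (- C) (y, S) -> A W = 0 -> symip C W = 0 ->
     (W : 'M[R]_n) *m S = 0 -> W = 0) ->
  exists kappa delta, [/\ 0 < kappa, 0 < delta & uniform_growth kappa delta].
Proof.
move=> [XsG Xsmin] surj sf sharp; apply: contrapT => ngr.
have [eta0 AX0 _] := sf.
have /choice[q Hq] : forall k : nat, exists q : symM R n * symM R n * symM R n,
   [/\ [/\ nrm q.1.1 <= k.+1%:R^-1, feasible A b q.1.2 & feasible A b q.2],
       nrm (q.1.2 - Xs) <= k.+1%:R^-1, nrm (q.2 - Xs) <= k.+1%:R^-1,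
       normal_cone symip (feasible A b) q.1.2 (q.1.1 - C) &
       symip (C - q.1.1) (q.2 - q.1.2) < k.+1%:R^-1 * nrm (q.2 - q.1.2) ^+ 2].
  move=> k; apply: contrapT => nq; apply: ngr.
  have k0 : 0 < k.+1%:R^-1 :> R by rewrite invr_gt0 ltr0n.
  exists k.+1%:R^-1, k.+1%:R^-1; split=> // V X Y hV XG YG hX hY hN.
  rewrite leNgt; apply/negP => h; apply: nq; exists (V, X, Y).
  by split; [split|exact: hX|exact: hY|exact: hN|exact: h].
pose V k := (q k).1.1; pose X k := (q k).1.2; pose Y k := (q k).2.
pose t k := nrm (Y k - X k); pose W k := (t k)^-1 *: (Y k - X k).
have Vk k : nrm (V k) <= k.+1%:R^-1.
  exact: (let: And5 g _ _ _ _ := Hq k in let: And3 h _ _ := g in h).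
have XG k : feasible A b (X k).
  exact: (let: And5 g _ _ _ _ := Hq k in let: And3 _ h _ := g in h).
have YG k : feasible A b (Y k).
  exact: (let: And5 g _ _ _ _ := Hq k in let: And3 _ _ h := g in h).
have Xk k : nrm (X k - Xs) <= k.+1%:R^-1.
  exact: (let: And5 _ h _ _ _ := Hq k in h).
have Yk k : nrm (Y k - Xs) <= k.+1%:R^-1.
  exact: (let: And5 _ _ h _ _ := Hq k in h).
have Nk k : normal_cone symip (feasible A b) (X k) (V k - C).
  exact: (let: And5 _ _ _ h _ := Hq k in h).
have gap k : symip (C - V k) (Y k - X k) < k.+1%:R^-1 * t k ^+ 2.
  exact: (let: And5 _ _ _ _ h := Hq k in h).
clearbody V X Y; clear q Hq ngr.
have t0 k : 0 < t k.
  apply: nrm_gt0; apply/eqP => h; have := gap k.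
  by rewrite /t h symip0r nrm0 expr0n mulr0 ltxx.
have /choice[ys Hy] : forall k, exists yS : 'cV[R]_m * symM R n,
    normal_cone symip psd (X k) yS.2 /\ adjoint A yS.1 + yS.2 = V k - C.
  move=> k; have [Xp AX] := XG k.
  by have [y [S h]] := multiplier_exists surj sf Xp AX (Nk k); exists (y, S).
pose y k := (ys k).1; pose S k := (ys k).2.
have SN k : normal_cone symip psd (X k) (S k) by have [] := Hy k.
have yS k : adjoint A (y k) + S k = V k - C by have [] := Hy k.
clearbody y S; clear ys Hy.
have inv1 k : k.+1%:R^-1 <= 1 :> R by rewrite invf_le1 ?ler1n ?ltr0n.
pose cS := (1 + nrm C) * (nrm X0 + (nrm Xs + 1)) / eta.
have Sc k : nrm (S k) <= cS.
  rewrite ler_pdivlMr // mulrC; have [Xp AX] := XG k.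
  apply: le_trans (normal_cone_bound sf Xp AX (SN k) (yS k)) _.
  apply: ler_pM; rewrite ?nrm_ge0 //.
    by apply: le_trans (nrmB _ _) _; rewrite lerD2r (le_trans (Vk k)).
  apply: le_trans (nrmB _ _) _; rewrite lerD2l.
  by apply: le_trans (nrm_split _ Xs) _; rewrite lerD2l (le_trans (Xk k)).
have VL : scvg V 0.
  by apply: (@scvg_squeeze _ _ _ _ 1) => k; rewrite subr0 mul1r.
have XL : scvg X Xs by apply: (@scvg_squeeze _ _ _ _ 1) => k; rewrite mul1r.
have [T ST] := scvg_exists Sc.
have W1 k : nrm (W k) = 1.
  by rewrite /W nrmZ ger0_norm ?invr_ge0 ?nrm_ge0 // mulVf // gt_eqF.
have [|Wl WL] := @scvg_exists _ _ W 1; first by move=> k; rewrite W1.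
have Wl1 : symip Wl Wl = 1.
  by apply: ulim_unique (ulim_symip WL WL) (ulim_const _) => k; rewrite -sqr_nrm W1 expr1n.
have AW : A Wl = 0.
  apply: mcvg_unique (mcvg_linear WL) _ => i j; apply: ulim_const => k.
  by rewrite /W linearZ linearB /= (XG k).2 (YG k).2 subrr scaler0.
have Tn : psd (- T).
  apply: scvg_psd (scvgN ST) => k.
  by have [] := (normal_cone_psdP _ (XG k).1).1 (SN k).
have TX : symip T Xs = 0.
  apply: ulim_unique (ulim_symip ST XL) (ulim_const _) => k.
  by have [] := (normal_cone_psdP _ (XG k).1).1 (SN k).
have TN : normal_cone symip psd Xs T by apply/(normal_cone_psdP _ XsG.1).
have [|yl ylE] := @adjoint_range_closed _ _ _ A y (- C - T) surj.
  have -> : (fun k => adjoint A (y k)) = (fun k => V k - C - S k).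
    by apply/funext => k; rewrite -yS addrK.
  by have := scvgB (scvgB VL (scvg_cst C)) ST; rewrite sub0r.
have mult : multipliers A b Xs (- C) (yl, T).
  split=> //=; last by rewrite ylE subrK.
  by move=> Z ZG; rewrite symipNl oppr_le0 symipBr subr_ge0 Xsmin.
(* X k S k = 0, so W k S k only involves Y k, whose complementarity gap is small *)
have WT0 : (Wl : 'M[R]_n) *m T = 0.
  pose c := fro (1%:M : 'M[R]_n).
  have WSL := mcvgM WL ST.
  apply: mxip_eq0; apply: ulim_unique (ulim_mxip WSL WSL) _.
  apply: (@ulim0 _ _ (c * (nrm Xs + 1) * (c * cS))) => k.
  rewrite ger0_norm ?mxip_ge0 //.
  have [XS _] := normal_cone_mulmx0 (XG k).1 (SN k).
  have [Sn SX] := (normal_cone_psdP _ (XG k).1).1 (SN k).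
  have WS : (W k : 'M[R]_n) *m S k = - (t k)^-1 *: ((Y k : 'M[R]_n) *m (- S k : symM R n)).
    by rewrite /W /= -scalemxAl mulmxBl XS subr0 mulmxN scalerN scaleNr opprK.
  rewrite WS mxipZl mxipZr mulrA -expr2 sqrrN.
  have YS : mxip (Y k) (- S k : symM R n) <= k.+1%:R^-1 * t k ^+ 2.
    have -> : mxip (Y k) (- S k : symM R n) = symip (C - V k) (Y k - X k).
      rewrite -/(symip _ _) symipC symipNl -[C - V k]opprB -yS symipNl symipDl adjointP.
      by rewrite linearB /= (XG k).2 (YG k).2 subrr mxip0r add0r symipBr SX subr0.
    exact: ltW.
  have trY : \tr (Y k : 'M[R]_n) <= c * (nrm Xs + 1).
    apply: le_trans (mxtrace_le_fro _) _; rewrite ler_wpM2l ?fro_ge0 //.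
    by apply: le_trans (nrm_split _ Xs) _; rewrite lerD2l (le_trans (Yk k)).
  have trS : \tr (- S k : symM R n) <= c * cS.
    apply: le_trans (mxtrace_le_fro _) _; rewrite ler_wpM2l ?fro_ge0 //.
    by rewrite -/(nrm _) nrmN.
  have Yp := (psdP _).1 (YG k).1; have Snp := (psdP _).1 Sn.
  have trY0 := psdmx_tr_ge0 Yp; have trS0 := psdmx_tr_ge0 Snp.
  have := psdmx_mulmx_bound (symM_tr (Y k)) (symM_tr (- S k)) Yp Snp.
  move=> h; rewrite exprVn mulrC ler_pdivrMr ?exprn_gt0 // -(mulrA _ k.+1%:R^-1).
  apply: le_trans h _; apply: ler_pM => //; first by rewrite mulr_ge0.
    by have := (psdmx_trace_mul (symM_tr (Y k)) Yp Snp).1; rewrite /mxip symM_tr.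
  by apply: ler_pM.
have CW : symip C Wl = 0.
  have TW : symip T Wl = 0 by rewrite /symip /mxip symM_tr mxtrace_mulC WT0 mxtrace0.
  apply: oppr_inj; rewrite -symipNl oppr0.
  have -> : - C = adjoint A yl + T by case: mult.
  by rewrite symipDl adjointP AW mxip0r TW addr0.
have W0 := sharp _ _ _ mult AW CW WT0.
by move: Wl1; rewrite W0 symip0l => /eqP; rewrite eq_sym oner_eq0.
Qed.

End Tilt.

(** * Nondegeneracy *)

Section LinearAlgebra.
Context {R : realType}.

(** The pseudo-inverse inverts the nonzero eigenvalues; the convention [0^-1 = 0] takes
care of the other ones. *)
Lemma pseudo_inverse_exists n (M : 'M[R]_n) : M^T = M ->
  exists K, [/\ K^T = K, M *m K = K *m M, M *m K *m M = M & K *m M *m K = K].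
Proof.
move=> Ms; have [P [d [PP ME _]]] := symmetric_diagonalization Ms.
pose e := \row_i (d 0 i)^-1; pose K := P *m diag_mx e *m P^T.
have mulE (f g : 'rV[R]_n) : (P *m diag_mx f *m P^T) *m (P *m diag_mx g *m P^T) =
    P *m diag_mx (\row_i (f 0 i * g 0 i)) *m P^T.
  by rewrite -!mulmxA (mulmxA P^T) PP mul1mx (mulmxA (diag_mx f)) mulmx_diag.
exists K; split.
- by rewrite /K !trmx_mul trmxK tr_diag_mx mulmxA.
- rewrite ME !mulE; congr (_ *m diag_mx _ *m _); apply/rowP => i.
  by rewrite !mxE mulrC.
- rewrite ME !mulE; congr (_ *m diag_mx _ *m _); apply/rowP => i; rewrite !mxE.
  by have [->|di] := eqVneq (d 0 i) 0; rewrite ?mulr0 // mulfV // mul1r.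
- rewrite ME !mulE; congr (_ *m diag_mx _ *m _); apply/rowP => i; rewrite !mxE.
  by have [->|di] := eqVneq (d 0 i) 0; rewrite ?mulr0 ?invr0 ?mulr0 // mulVf // mul1r.
Qed.

Lemma fredholm p q (M : 'M[R]_(p, q)) (z : 'rV_q) :
  (forall w : 'cV_q, M *m w = 0 -> z *m w = 0) -> exists u, u *m M = z.
Proof.
move=> h; suff /submxP[u ->] : (z <= M)%MS by exists u.
rewrite submxE; apply/eqP/matrixP => i j.
have : z *m col j (cokermx M) = 0.
  by apply: h; rewrite colE mulmxA mulmx_coker mul0mx.
move/matrixP/(_ i 0); rewrite colE mulmxA -colE [LHS]mxE => ->.
by rewrite !mxE.
Qed.

End LinearAlgebra.

Section Nondegeneracy.
Context {R : realType} {n m : nat}.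
Variables (A : {linear symM R n -> 'cV[R]_m}) (b : 'cV[R]_m).
Implicit Types (X Y Z S V W : symM R n) (y w : 'cV[R]_m).

Lemma adjointN y : adjoint A (- y) = - adjoint A y.
Proof. by apply: symip_testP => Z; rewrite symipNl !adjointP mxipNl. Qed.

Lemma adjoint0 : adjoint A 0 = 0.
Proof. by apply: symip_testP => Z; rewrite symip0l adjointP mxip0l. Qed.

(** The matrices [sympart (delta_mx i j)] span the symmetric matrices, and testing
against them reads off entries. *)
Lemma sympart_delta Z i j : symip Z (sympart (delta_mx i j)) = (Z : 'M[R]_n) i j.
Proof.
have E k l : mxip Z (delta_mx k l : 'M_n) = (Z : 'M[R]_n) k l.
  rewrite mxipE (bigD1 k) //= (bigD1 l) //= mxE !eqxx mulr1.
  rewrite !big1 ?addr0 // => [k' kk'|l' ll'].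
    by rewrite big1 // => l' _; rewrite mxE (negPf kk') mulr0.
  by rewrite mxE eqxx (negPf ll') mulr0.
rewrite /symip /= mxipZr mxipDr trmx_delta !E.
have -> : (Z : 'M[R]_n) j i = (Z : 'M[R]_n) i j by rewrite -{1}(symM_tr Z) mxE.
by move: ((Z : 'M[R]_n) i j) => z; field.
Qed.

Lemma normal_cone_psd0 X : psd X -> normal_cone symip psd X 0.
Proof.
move=> Xp; apply/(normal_cone_psdP _ Xp); split; last exact: symip0l.
by apply/psdP => u; rewrite /= oppr0 mul0mx mxip0r.
Qed.

(** With [c] the norm of [Z], both [Z - c P] and [- c P] are normal directions and
[Z] is their difference. *)
Lemma Sp_normal_cone X (P : 'M[R]_n) Z : psd X -> P^T = P -> P *m P = P ->
  X *m P = 0 -> P *m Z *m P = Z -> Sp (normal_cone symip psd X) Z.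
Proof.
move=> Xp Ps PP XP PZP.
have Psym : P \in symmx R n by rewrite symmxE Ps.
pose P' : symM R n := SymM Psym.
have PX : P *m X = 0 by apply: trmx_inj; rewrite trmx_mul Ps symM_tr XP trmx0.
have ZX : symip Z X = 0.
  by rewrite /symip -PZP -mulmxA mxip_mull Ps /mxip trmx_mul Ps -!mulmxA PX !mulmx0 mxtrace0.
have P'X : symip P' X = 0 by rewrite /symip /mxip /= Ps PX mxtrace0.
exists 1, (Z - nrm Z *: P'), (- (nrm Z *: P')); split=> //.
- apply/(normal_cone_psdP _ Xp); split; last first.
    by rewrite symipBl symipZl ZX P'X mulr0 subr0.
  apply/psdP => u.
  have PPu : mxip u (P *m u) = mxip (P *m u) (P *m u).
    by rewrite mxip_mull Ps mulmxA PP.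
  have ZPu : mxip u ((Z : 'M[R]_n) *m u) = mxip (P *m u) ((Z : 'M[R]_n) *m (P *m u)).
    by rewrite -{1}PZP mxip_mull Ps !mulmxA.
  rewrite /= mulNmx mxipNr mulmxBl mxipBr -scalemxAl mxipZr PPu ZPu opprB subr_ge0.
  apply: le_trans (ler_norm _) _; apply: le_trans (mxip_CS _ _) _.
  rewrite -sqr_fro expr2 mulrA mulrC ler_wpM2r ?fro_ge0 //.
  exact: fro_mulmx.
- apply/(normal_cone_psdP _ Xp); rewrite opprK symipNl symipZl P'X mulr0 oppr0.
  split=> //; apply/psdP => u; rewrite /= -scalemxAl mxipZr mulr_ge0 ?nrm_ge0 //.
  by rewrite -PP -mulmxA -{1}Ps -mxip_mull mxip_ge0.
- by rewrite scale1r opprK subrK.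
Qed.

(** By the Fredholm alternative, a right-hand side [(0, Z)] can fail to be reached by
[D |-> (A D, P D P)] only if some [(y, T)] with [adjoint A y + P T P = 0] separates
it.  But then the symmetric part of [P T P] lies in both the linear span of the normal
cone and the range of [adjoint A], hence vanishes. *)
Lemma nondegenerate_surjection X (P : 'M[R]_n) Z : psd X ->
  Sp (normal_cone symip psd X) `&` range (adjoint A) = [set 0] ->
  P^T = P -> P *m P = P -> X *m P = 0 -> P *m Z *m P = Z ->
  exists D, A D = 0 /\ P *m D *m P = Z.
Proof.
move=> Xp nd Ps PP XP PZP.
pose e (k : 'I_#|{: 'I_n * 'I_n}|) : symM R n :=
  sympart (delta_mx (enum_val k).1 (enum_val k).2).
pose M : 'M[R]_(_, m + n * n) :=
  \matrix_(k < _) row_mx (A (e k))^T (mxvec (P *m e k *m P)).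
have [|u uE] := @fredholm R _ _ M (row_mx 0 (mxvec (Z : 'M[R]_n))).
  move=> w Mw; rewrite -[w]vsubmxK mul_row_col mul0mx add0r.
  set y := usubmx w; pose T : 'M[R]_n := vec_mx (dsubmx w)^T.
  have dwE : dsubmx w = (mxvec T)^T by rewrite /T vec_mxK trmxK.
  have mvE (B C : 'M[R]_n) : (mxvec B *m (mxvec C)^T) 0 0 = mxip B C.
    rewrite mxE mxipE pair_bigA /= (reindex _ (curry_mxvec_bij _ _)) /=.
    by apply: eq_bigr => -[i j] _; rewrite mxE !mxvecE.
  pose Q := sympart (P *m T *m P).
  have QZ (C : symM R n) : symip Q C = mxip (P *m T *m P) C.
    rewrite /symip /= mxipZl mxipDl -(mxip_tr (_^T)) trmxK symM_tr.
    by move: (mxip _ _) => z; field.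
  have ek k : mxip y (A (e k)) + mxip (P *m T *m P) (e k) = 0.
    have : row k M *m w = 0 by rewrite -row_mul Mw row0.
    rewrite rowK -[w]vsubmxK mul_row_col dwE => /matrixP/(_ 0 0).
    rewrite mxE mvE [RHS]mxE => <-; congr (_ + _).
      by rewrite mxipC /mxip /mxtrace big_ord1.
    by rewrite mxip_mulr Ps mxip_mull Ps mxipC mulmxA.
  have yQ : adjoint A y + Q = 0.
    apply: val_inj; apply/matrixP => i j; have := ek (enum_rank (i, j)).
    rewrite /e enum_rankK -QZ -adjointP -symipDl sympart_delta => ->.
    by rewrite mxE.
  have Q0 : Q = 0.
    have : (Sp (normal_cone symip psd X) `&` range (adjoint A)) Q.
      split; last first.
        exists (- y) => //; rewrite adjointN; apply/eqP.
        by rewrite eq_sym -addr_eq0 addrC yQ.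
      apply: (Sp_normal_cone Xp Ps PP XP).
      have h1 : P *m (P *m T *m P) *m P = P *m T *m P.
        by rewrite !mulmxA PP -!mulmxA PP.
      have trc (B : 'M[R]_n) : (P *m B *m P)^T = P *m B^T *m P.
        by rewrite !trmx_mul Ps mulmxA.
      have h2 : P *m (P *m T *m P)^T *m P = (P *m T *m P)^T by rewrite -trc h1.
      by rewrite /= -scalemxAr -scalemxAl mulmxDr mulmxDl h1 h2.
    by rewrite nd.
  apply/matrixP => i j; rewrite !ord1 [RHS]mxE dwE mvE.
  by rewrite -PZP mxip_mulr Ps mxip_mull Ps mulmxA mxipC -QZ Q0 symip0l.
exists (\sum_k u 0 k *: e k).
have : u *m M = row_mx (A (\sum_k u 0 k *: e k))^T
    (mxvec (P *m (\sum_k u 0 k *: e k : symM R n) *m P)).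
  have AE : A (\sum_k u 0 k *: e k) = \sum_k u 0 k *: A (e k).
    by rewrite linear_sum; apply: eq_bigr => k _; rewrite linearZ.
  have PE : P *m (\sum_k u 0 k *: e k : symM R n) *m P =
      \sum_k u 0 k *: (P *m e k *m P).
    rewrite [val _]raddf_sum mulmx_sumr mulmx_suml; apply: eq_bigr => k _.
    by rewrite /= -scalemxAr -scalemxAl.
  rewrite mulmx_sum_row AE PE; apply/rowP => l; rewrite summxE.
  have [l' ->|l' ->] := split_ordP l.
    rewrite row_mxEl mxE summxE; apply: eq_bigr => k _.
    by rewrite rowK [LHS]mxE row_mxEl !mxE.
  rewrite row_mxEr linear_sum summxE; apply: eq_bigr => k _.
  rewrite rowK [LHS]mxE row_mxEr; move: (P *m e k *m P) => B.
  by rewrite linearZ [RHS]mxE.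
rewrite uE => /eq_row_mx[/(congr1 trmx) + /(congr1 vec_mx)].
by rewrite trmx0 trmxK !mxvecK => <- <-.
Qed.

(** A normal direction [U] in the range of the adjoint is orthogonal to [X0 - X], so
[<U, X0> = <U, X> = 0]; a negative semidefinite matrix orthogonal to the positive
definite [X0] is zero. *)
Lemma normal_cone_trivial eta X0 X : strictly_feasible A b eta X0 -> psd X -> A X = b ->
  Sp (normal_cone symip psd X) `<=` range (adjoint A) ->
  Sp (normal_cone symip psd X) `&` range (adjoint A) = [set 0].
Proof.
move=> sf Xp AX sub.
have N0 U : normal_cone symip psd X U -> U = 0.
  move=> UN; have [Un UX] := (normal_cone_psdP _ Xp).1 UN.
  have /sub[y _ yU] : Sp (normal_cone symip psd X) U.
    exists 1, U, 0; split=> //; first exact: normal_cone_psd0.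
    by rewrite scale1r subr0.
  have [eta0 AX0 _] := sf.
  have UX0 : symip U X0 = 0.
    by rewrite -[X0](subrK X) symipDr UX addr0 -yU adjointP linearB /= AX AX0 subrr mxip0r.
  have := slater_trace sf Un; rewrite UX0 oppr0 pmulr_rle0 // => h.
  by apply: symip_eq0; rewrite -sqr_nrm (le_anti (_ : nrm U <= 0 <= nrm U)) ?expr0n // h nrm_ge0.
apply/seteqP; split=> [w [[t [u [v [t0 /N0 -> /N0 -> ->]]]] _]|w ->].
  by rewrite subrr scaler0.
split; last by exists 0; rewrite ?adjoint0.
exists 0, 0, 0; split=> //; try exact: normal_cone_psd0.
by rewrite scale0r.
Qed.

End Nondegeneracy.

(** * Second-order arcs in the psd cone *)

(** The error terms of [perturbation_psd] are absorbed by the squares on the right, in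
which [x], [y], [z] come with the different weights [1], [e], [e^2].  Put
[w = e M z]; every mixed product is split by the inequality of arithmetic and
geometric means into multiples of [e x^2], [e y^2] and [e w^2], and [e w^2] is of
order [e^3 z^2]. *)
Lemma absorb_cross_terms (R : realType) (c eta M : R) : 0 < c -> 0 < eta -> 1 <= M ->
  exists2 e0 : R, 0 < e0 & e0 <= 1 /\ forall e x y z p : R, 0 < e -> e <= e0 ->
    0 <= x -> 0 <= y -> 0 <= z -> 0 <= p -> p <= x + e * M * z ->
    e * (M * (p ^+ 2 + 2 * (p * y))) + e ^+ 2 * (M * (p ^+ 2 + 2 * (p * y) + 2 * (p * z)))
    <= c * x ^+ 2 + e * (2^-1 * y ^+ 2) + e ^+ 2 * (eta * z ^+ 2).
Proof.
move=> c0 eta0 M1; pose G := 4 * M + 32 * M ^+ 2 + 3.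
have M0 : 0 < M by lra.
have M20 : 0 < M ^+ 2 by rewrite exprn_gt0.
have G0 : 0 < G by rewrite /G; lra.
exists (Num.min 1 (Num.min (c / G) (eta / (G * M ^+ 2)))).
  by rewrite !lt_min ltr01 !divr_gt0 // mulr_gt0.
split; first by rewrite ge_min lexx.
move=> e x y z p e_gt0; rewrite !le_min => /andP[e1 /andP[eG eGM]] x0 y0 z0 p0 pw.
rewrite ler_pdivlMr // in eG; rewrite ler_pdivlMr ?mulr_gt0 // in eGM.
set w := e * M * z in pw; have w0 : 0 <= w by rewrite !mulr_ge0 // ltW.
have xw0 := sqr_ge0 (x - w).
have h1 : p ^+ 2 <= 2 * x ^+ 2 + 2 * w ^+ 2.
  have : p * p <= (x + w) * (x + w) by apply: ler_pM.
  by move: xw0; clearbody w; clear; lra.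
have h2 : 4 * M * (p * y) <= 4^-1 * y ^+ 2 + 32 * M ^+ 2 * (x ^+ 2 + w ^+ 2).
  have h4 : 4 * M * (p * y) <= 4 * M * ((x + w) * y).
    by rewrite ler_pM2l ?mulr_gt0 // ler_wpM2r.
  apply: le_trans h4 _.
  have := sqr_ge0 (y - 16 * M * x); have := sqr_ge0 (y - 16 * M * w).
  clearbody w; clear; lra.
have h3 : 2 * (p * w) <= x ^+ 2 + 3 * w ^+ 2.
  have : p * w <= (x + w) * w by rewrite ler_wpM2r.
  by move: xw0; clearbody w; clear; lra.
have hw : e ^+ 2 * (M * (2 * (p * z))) = e * (2 * (p * w)) by rewrite /w; ring.
have s1 : e * (M * p ^+ 2) + e ^+ 2 * (M * p ^+ 2) <= e * (4 * M * (x ^+ 2 + w ^+ 2)).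
  have -> : e * (M * p ^+ 2) + e ^+ 2 * (M * p ^+ 2) = e * ((1 + e) * (M * p ^+ 2)) by ring.
  rewrite ler_pM2l //; have : M * p ^+ 2 <= M * (2 * x ^+ 2 + 2 * w ^+ 2) by rewrite ler_pM2l.
  have : 0 <= M * p ^+ 2 by rewrite mulr_ge0 ?sqr_ge0 ?(ltW M0).
  by move: (p ^+ 2) e1 => p2; clear; nra.
have s2 : e * (M * (2 * (p * y))) + e ^+ 2 * (M * (2 * (p * y))) <=
    e * (4^-1 * y ^+ 2 + 32 * M ^+ 2 * (x ^+ 2 + w ^+ 2)).
  have -> : e * (M * (2 * (p * y))) + e ^+ 2 * (M * (2 * (p * y))) =
    e * ((1 + e) * (2 * (M * (p * y)))) by ring.
  rewrite ler_pM2l //; apply: le_trans h2.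
  have Mpy : 0 <= M * (p * y) by rewrite mulr_ge0 ?(ltW M0) ?mulr_ge0.
  rewrite -mulrA; move: (M * (p * y)) Mpy e1 => q; clear; nra.
have s3 : e * (2 * (p * w)) <= e * (x ^+ 2 + 3 * w ^+ 2) by rewrite ler_pM2l.
have xG : e * G * x ^+ 2 <= c * x ^+ 2 by rewrite ler_wpM2r ?sqr_ge0.
have wG : e * G * w ^+ 2 <= e ^+ 2 * (eta * z ^+ 2).
  have -> : e * G * w ^+ 2 = e ^+ 2 * (e * (G * M ^+ 2) * z ^+ 2) by rewrite /w; ring.
  by rewrite ler_pM2l ?exprn_gt0 // ler_wpM2r ?sqr_ge0.
have y20 : 0 <= e * y ^+ 2 by rewrite mulr_ge0 ?sqr_ge0 ?(ltW e_gt0).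
have x20 : 0 <= e * x ^+ 2 by rewrite mulr_ge0 ?sqr_ge0 ?(ltW e_gt0).
move: hw s1 s2 s3 xG wG y20 x20; rewrite /G; clearbody w; clear; lra.
Qed.

(** [K] is the pseudo-inverse of [X], so [P0] projects onto the kernel of [X], and
[Pg] projects onto a part of this kernel.  The arc [X + e D + e^2 B] leaves [X] so as
to become positive on the range of [P0 - Pg] at first order, while on the range of
[Pg] the first-order term vanishes and the second-order term exceeds by [eta] the
value [D K D] at which the Schur complement is zero. *)
Section Perturbation.
Context {R : realType} {n : nat}.
Variables (X K Pg D B : 'M[R]_n) (eta : R).
Hypotheses (Xs : X^T = X) (Xp : psdmx X) (Ks : K^T = K) (XKC : X *m K = K *m X)
  (XKX : X *m K *m X = X) (KXK : K *m X *m K = K).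
Hypotheses (Pgs : Pg^T = Pg) (PgPg : Pg *m Pg = Pg) (XPg : X *m Pg = 0).
Hypotheses (Ds : D^T = D) (Bs : B^T = B).
Let P0 := 1%:M - X *m K.
Hypothesis DPg : P0 *m D *m Pg = 0.
Hypothesis BE : P0 *m B *m P0 = Pg *m (D *m K *m D) *m Pg + eta *: Pg.

Lemma kerproj_tr : P0^T = P0.
Proof. by rewrite linearB /= trmx1 trmx_mul Xs Ks -XKC. Qed.

Lemma kerproj_idem : P0 *m P0 = P0.
Proof.
rewrite {1}/P0 mulmxBl mul1mx {2}/P0 mulmxBr mulmx1 !mulmxA XKX.
by rewrite subrr subr0.
Qed.

Lemma mulmx_kerproj : X *m P0 = 0.
Proof. by rewrite /P0 mulmxBr mulmx1 XKC mulmxA XKX subrr. Qed.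

Lemma kerproj_sub : P0 *m Pg = Pg.
Proof. by rewrite /P0 mulmxBl mul1mx XKC -mulmxA XPg mulmx0 subr0. Qed.

Lemma sub_kerproj : Pg *m P0 = Pg.
Proof. by apply: trmx_inj; rewrite trmx_mul kerproj_tr Pgs kerproj_sub. Qed.

Let PgDPg : Pg *m D *m Pg = 0.
Proof. by rewrite -{1}sub_kerproj -!mulmxA (mulmxA P0) DPg mulmx0. Qed.

Let PgBPg : Pg *m B *m Pg = Pg *m (D *m K *m D) *m Pg + eta *: Pg.
Proof.
have -> : Pg *m B *m Pg = Pg *m (P0 *m B *m P0) *m Pg.
  by rewrite -{1}sub_kerproj -{2}kerproj_sub !mulmxA.
rewrite BE mulmxDr mulmxDl -scalemxAr -scalemxAl PgPg; congr (_ + _).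
  by rewrite !mulmxA PgPg -!mulmxA PgPg.
by rewrite PgPg.
Qed.

(** Split [u = a + bv + g] according to [X K], [P0 - Pg] and [Pg].  The terms
[a X a + 2 e a D g + e^2 g D K D g] complete to the square of
[h = a + e K D g] for the form [X], which leaves [c |h|^2 + e |bv|^2 / 2 + e^2 eta |g|^2]
against smaller cross terms. *)
Lemma perturbation_psd : 0 < eta ->
  (forall u : 'cV_n, 2^-1 * mxip ((P0 - Pg) *m u) ((P0 - Pg) *m u) <=
     mxip ((P0 - Pg) *m u) (D *m ((P0 - Pg) *m u))) ->
  exists2 e0 : R, 0 < e0 & forall e, 0 < e -> e <= e0 ->
    psdmx (X + e *: D + e ^+ 2 *: B).
Proof.
move=> eta0 Dbb.
pose M := 1 + fro D + fro B + fro (K *m D).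
have M1 : 1 <= M.
  by rewrite /M; have := fro_ge0 D; have := fro_ge0 B; have := fro_ge0 (K *m D); lra.
have DM : fro D <= M.
  by rewrite /M; have := fro_ge0 B; have := fro_ge0 (K *m D); lra.
have BM : fro B <= M.
  by rewrite /M; have := fro_ge0 D; have := fro_ge0 (K *m D); lra.
have KDM : fro (K *m D) <= M.
  by rewrite /M; have := fro_ge0 D; have := fro_ge0 B; lra.
pose c := (fro K ^+ 2 * \tr X + 1)^-1.
have trX0 := psdmx_tr_ge0 Xp.
have cd0 : 0 < fro K ^+ 2 * \tr X + 1 by rewrite ltr_wpDl // mulr_ge0 ?sqr_ge0.
have c0 : 0 < c by rewrite invr_gt0.
have [e0 e00 [e01 absorb]] := absorb_cross_terms c0 eta0 M1.
exists e0 => // e e_gt0 ee0 u.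
pose a := X *m K *m u; pose bv := (P0 - Pg) *m u; pose g := Pg *m u.
pose h := a + e *: (K *m (D *m g)).
have uE : u = a + (bv + g).
  by rewrite /a /bv /g -mulmxDl subrK -mulmxDl addrC /P0 subrK mul1mx.
have wE : bv + g = P0 *m u by rewrite /bv /g -mulmxDl subrK.
have Xw : X *m (bv + g) = 0 by rewrite wE mulmxA mulmx_kerproj mul0mx.
have sym_form (Y : 'M[R]_n) (v w : 'cV_n) : Y^T = Y -> mxip (v + w) (Y *m (v + w)) =
    mxip v (Y *m v) + 2 * mxip v (Y *m w) + mxip w (Y *m w).
  move=> Ys; rewrite mulmxDr mxipDl !mxipDr.
  by have -> : mxip w (Y *m v) = mxip v (Y *m w);
    [rewrite mxipC mxip_mull Ys|ring].
have bound (Y : 'M[R]_n) (v w : 'cV_n) : fro Y <= M ->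
    - (M * (fro v * fro w)) <= mxip v (Y *m w).
  move=> YM; have := mxip_CS v (Y *m w); rewrite ler_norml => /andP[+ _].
  apply: le_trans; rewrite lerN2 mulrCA ler_wpM2l ?fro_ge0 //.
  by apply: le_trans (fro_mulmx _ _) _; rewrite ler_wpM2r ?fro_ge0.
have XKa : X *m K *m a = a by rewrite /a !mulmxA XKX.
have hX : mxip h (X *m h) = mxip a (X *m a) + 2 * e * mxip a (D *m g) +
    e ^+ 2 * mxip g (D *m K *m D *m g).
  rewrite /h sym_form // -scalemxAr mxipZl !mxipZr (mulmxA X K).
  have -> : mxip a (X *m K *m (D *m g)) = mxip a (D *m g).
    by rewrite -{2}XKa [RHS]mxip_mull trmx_mul Xs Ks -XKC.
  have -> : mxip (K *m (D *m g)) (X *m K *m (D *m g)) = mxip g (D *m K *m D *m g).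
    by rewrite mxip_mull Ks !mulmxA KXK -!mulmxA mxip_mull Ds !mulmxA.
  ring.
have XKh : X *m K *m h = h.
  by rewrite /h mulmxDr XKa -scalemxAr (mulmxA _ K) XKC KXK.
(* h = K X h and X^2 <= (tr X) X *)
have hc : c * fro h ^+ 2 <= mxip h (X *m h).
  rewrite /c mulrC ler_pdivrMr // sqr_fro.
  have Xh : mxip (X *m h) (X *m h) <= \tr X * mxip h (X *m h).
    have := (psdmx_trace_mul Xs Xp (proj1 (psdP _) (outer_psd h))).2.
    have outE (Y : 'M[R]_n) : \tr (Y *m outer h) = mxip h (Y *m h).
      by rewrite /= mulmxA mxtrace_mulC.
    by rewrite !outE -mulmxA -{1}Xs mxip_mull.
  have : mxip h h <= fro K ^+ 2 * (\tr X * mxip h (X *m h)).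
    rewrite -{1 2}XKh XKC -mulmxA; apply: le_trans (mxip_mulmx_le _ _) _.
    by rewrite sqr_fro ler_wpM2l ?mxip_ge0.
  have := Xp h; move: (mxip h h) (mxip h (X *m h)) (fro K ^+ 2) (\tr X) => p q r s.
  nra.
have p_le : fro a <= fro h + e * M * fro g.
  have -> : a = h - e *: (K *m (D *m g)) by rewrite /h addrK.
  apply: le_trans (froD _ _) _; rewrite froN froZ gtr0_norm // lerD2l -mulrA.
  rewrite ler_pM2l // mulmxA; apply: le_trans (fro_mulmx _ _) _.
  by rewrite ler_wpM2r ?fro_ge0.
have bDg : mxip bv (D *m g) = 0.
  have -> : bv = P0 *m bv by rewrite /bv mulmxA mulmxBr kerproj_idem kerproj_sub.
  rewrite mxip_mull kerproj_tr /g !mulmxA DPg mul0mx mxip0r //.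
have gDg : mxip g (D *m g) = 0.
  by rewrite {1}/g mxip_mull Pgs /g !mulmxA PgDPg mul0mx mxip0r.
have wBw : mxip (bv + g) (B *m (bv + g)) = mxip g (D *m K *m D *m g) + eta * fro g ^+ 2.
  rewrite wE mxip_mull kerproj_tr !mulmxA BE mulmxDl mxipDr -scalemxAl mxipZr.
  rewrite sqr_fro; congr (_ + _ * _).
    by rewrite -{1}Pgs -!mulmxA -mxip_mull.
  by rewrite /g mxip_mull Pgs mulmxA PgPg.
have Dbb' : 2^-1 * fro bv ^+ 2 <= mxip bv (D *m bv) by rewrite sqr_fro; exact: Dbb.
have := absorb e (fro h) (fro bv) (fro g) (fro a) e_gt0 ee0
  (fro_ge0 _) (fro_ge0 _) (fro_ge0 _) (fro_ge0 _) p_le.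
have aa := bound D a a DM; have ab := bound D a bv DM.
have Baa := bound B a a BM; have Bab := bound B a bv BM; have Bag := bound B a g BM.
have qE (Y : 'M[R]_n) : Y^T = Y -> mxip u (Y *m u) =
    mxip a (Y *m a) + 2 * mxip a (Y *m (bv + g)) + mxip (bv + g) (Y *m (bv + g)).
  by move=> Ys; rewrite [in LHS]uE sym_form.
have wDw : mxip (bv + g) (D *m (bv + g)) = mxip bv (D *m bv).
  by rewrite sym_form // bDg gDg; ring.
have aDw : mxip a (D *m (bv + g)) = mxip a (D *m bv) + mxip a (D *m g).
  by rewrite mulmxDr mxipDr.
have aBw : mxip a (B *m (bv + g)) = mxip a (B *m bv) + mxip a (B *m g).
  by rewrite mulmxDr mxipDr.
have e2 : 0 < e ^+ 2 by rewrite exprn_gt0.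
rewrite !mulmxDl -!scalemxAl !mxipDr !mxipZr !qE // Xw mxip0r mxip0r.
rewrite wDw aDw wBw aBw; move: hc hX Dbb' aa ab Baa Bab Bag.
move: (mxip a (X *m a)) (mxip h (X *m h)) (mxip a (D *m a)) (mxip a (D *m bv)).
move: (mxip a (D *m g)) (mxip bv (D *m bv)) (mxip g _) (mxip a (B *m a)).
move: (mxip a (B *m bv)) (mxip a (B *m g)) (fro h) (fro bv) (fro g) (fro a).
move=> aBb aBg x y z p aDg bDb gEg aBa aXa hXh aDa aDb hc hX hb h1 h2 h3 h4 h5.
have s1 : e * (- (M * (p ^+ 2 + 2 * (p * y))) + 2^-1 * y ^+ 2) <= e * (aDa + 2 * aDb + bDb).
  rewrite ler_pM2l //; lra.
have s2 : e ^+ 2 * (- (M * (p ^+ 2 + 2 * (p * y) + 2 * (p * z)))) <=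
    e ^+ 2 * (aBa + 2 * aBb + 2 * aBg).
  rewrite ler_pM2l //; lra.
lra.
Qed.

Lemma conj_expand (U G Y : 'M[R]_n) (e : R) :
  (U - e *: G)^T *m Y *m (U - e *: G) =
  U^T *m Y *m U - e *: (U^T *m Y *m G + G^T *m Y *m U) + e ^+ 2 *: (G^T *m Y *m G).
Proof.
have -> : (U - e *: G)^T = U^T - e *: G^T by rewrite linearB linearZ.
rewrite !(mulmxBl, mulmxBr) -!(scalemxAl, scalemxAr) -?(scalemxAl, scalemxAr).
move: (_ *m U) (_ *m G) (G^T *m Y *m U) (G^T *m Y *m G) => a b c d.
by apply/matrixP => i j; rewrite !mxE; ring.
Qed.

(** [1 - e K D] moves the range of [E], up to second order, into the kernel of the arc:
in the compression by [Pg - e K D Pg], the terms of order 0 and 1 vanish and the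
ones of order 2 sum to [B - D K D], whose compression by [Pg] is [eta Pg]. *)
Lemma perturbation_gap (E : 'M[R]_n) : E *m Pg = E -> Pg *m E = E ->
  exists c : R, forall e, 0 < e -> e <= 1 ->
    mxip ((1%:M - e *: (K *m D)) *m E *m (1%:M - e *: (K *m D))^T)
         (X + e *: D + e ^+ 2 *: B) <= e ^+ 2 * (eta * \tr E) + e ^+ 3 * c.
Proof.
move=> EPg PgE; pose G := K *m D *m Pg; pose F := Pg *m (D *m K *m D) *m Pg.
have GT : G^T = Pg *m D *m K by rewrite /G !trmx_mul Ks Ds Pgs mulmxA.
have PgX : Pg *m X = 0 by apply: trmx_inj; rewrite trmx_mul Xs Pgs XPg trmx0.
have GXG : G^T *m X *m G = F by rewrite GT /G /F -!mulmxA (mulmxA K) (mulmxA (K *m X)) KXK.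
have PgDG : Pg *m D *m G = F by rewrite /G /F !mulmxA.
have GDPg : G^T *m D *m Pg = F by rewrite GT /F !mulmxA.
pose c3 := mxip E (G^T *m D *m G - (Pg *m B *m G + G^T *m B *m Pg)).
pose c4 := mxip E (G^T *m B *m G).
exists (`|c3| + `|c4|) => e e0 e1.
have -> : (1%:M - e *: (K *m D)) *m E *m (1%:M - e *: (K *m D))^T =
    (Pg - e *: G) *m E *m (Pg - e *: G)^T.
  have LPg : (1%:M - e *: (K *m D)) *m Pg = Pg - e *: G.
    by rewrite mulmxBl mul1mx -scalemxAl.
  by rewrite -LPg trmx_mul Pgs !mulmxA -(mulmxA _ Pg E) PgE -(mulmxA _ E Pg) EPg.
have [U UE] : exists U, U = Pg - e *: G by exists (Pg - e *: G).
rewrite -UE mxip_mulr trmxK mxip_mull mulmxA !(mulmxDr, mulmxDl) -!(scalemxAr, scalemxAl).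
have GXPg : G^T *m X *m Pg = 0 by rewrite -mulmxA XPg mulmx0.
rewrite UE !conj_expand !Pgs GXG PgDG GDPg PgDPg PgBPg -/F GXPg PgX.
rewrite ?mul0mx ?mulmx0.
have trE : mxip E Pg = \tr E.
  by rewrite mxipC /mxip Pgs PgE.
have c34 : e ^+ 3 * c3 + e ^+ 4 * c4 <= e ^+ 3 * (`|c3| + `|c4|).
  have -> : e ^+ 3 * c3 + e ^+ 4 * c4 = e ^+ 3 * (c3 + e * c4) by ring.
  rewrite ler_pM2l ?exprn_gt0 //; apply: lerD; first exact: ler_norm.
  apply: le_trans (ler_norm _) _; rewrite normrM ler_piMl ?normr_ge0 //.
  by rewrite gtr0_norm.
apply: le_trans (lerD (lexx _) c34); rewrite /c3 /c4 -trE.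
rewrite !(mxipDr, mxipBr, mxipNr, mxipZr, mxip0r, addr0, sub0r, subr0, add0r); lra.
Qed.

End Perturbation.

(** * Consequences of tilt stability *)

Section Necessity.
Context {R : realType} {n m : nat}.
Variables (A : {linear symM R n -> 'cV[R]_m}) (b : 'cV[R]_m) (C Xs : symM R n).
Implicit Types (X Y Z S V W : symM R n) (y w : 'cV[R]_m).

Lemma conj_sym (L : 'M[R]_n) S : L *m S *m L^T \in symmx R n.
Proof. by rewrite symmxE !trmx_mul trmxK symM_tr mulmxA. Qed.

Definition conj_symM (L : 'M[R]_n) S : symM R n := SymM (conj_sym L S).

Lemma symip_psd_ge0 S X : psd (- S) -> psd X -> 0 <= - symip S X.
Proof.
move=> Sn Xp; rewrite -symipNl /symip /mxip symM_tr.
exact: (psdmx_trace_mul (symM_tr _) ((psdP _).1 Sn) ((psdP _).1 Xp)).1.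
Qed.

(** For the tilt [S' - S], a feasible [X] has objective value [- <S', X>] up to a
constant, and this is nonnegative.  Push this tilt by [tau d] and by [- tau d], where
[d = X2 - X1]: comparing the two tilted minimizers with [X2] and [X1] shows that they
are about as far apart in the direction [d] as [X2] and [X1] are, unless the gaps are
large, while Lipschitz continuity keeps them within [2 L tau |d|].  The choice
[tau = 1 / (4 L')] makes the first effect dominate. *)
Lemma tilt_stable_gap y S : feasible A b Xs -> adjoint A y + S = - C ->
  sdp_tilt_stable A b C Xs ->
  exists c r : R, [/\ 0 < c, 0 < r & forall S' X1 X2, psd (- S') -> nrm (S' - S) <= r ->
    feasible A b X1 -> feasible A b X2 ->
    nrm (X1 - Xs) <= r -> nrm (X2 - Xs) <= r -> nrm (X2 - X1) <= r ->
    c * nrm (X2 - X1) ^+ 2 <= - symip S' X1 - symip S' X2].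
Proof.
move=> XsG yS [_ _ [delta d0 [[eps e0 [single [L lip]]] _]]].
have tP := fun V X => tilt_argminP C V X (ltW d0) XsG.
pose L' := `|L| + 1.
have L'0 : 0 < L' by rewrite ltr_wpDl.
have L'1 : 1 <= L' by rewrite lerDr.
pose tau := (4 * L')^-1.
have tau0 : 0 < tau by rewrite invr_gt0 mulr_gt0.
have tL : tau * L' = 4^-1 by rewrite /tau invfM mulfVK // gt_eqF.
have tau1 : tau <= 1.
  by have := ler_wpM2l (ltW tau0) L'1; rewrite tL; lra.
pose r := Num.min delta (eps / 2).
have r0 : 0 < r by rewrite lt_min d0 divr_gt0.
exists (tau / 2), r; split=> //; first by rewrite divr_gt0.
move=> S' X1 X2 Sn SS' X1G X2G X1r X2r X12r; set d := X2 - X1.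
have [rd re] : r <= delta /\ r <= eps / 2 by rewrite /r !ge_min !lexx orbT.
pose Vp := (S' - S) + tau *: d; pose Vm := (S' - S) - tau *: d.
have td : nrm (tau *: d) <= r.
  rewrite nrmZ gtr0_norm //; apply: le_trans X12r.
  by rewrite ler_piMl ?nrm_ge0.
have Vpe : cball symip 0 eps Vp.
  rewrite /cball /= subr0 enormE; apply: le_trans (nrmD _ _) _.
  by move: SS' td re; clear; lra.
have Vme : cball symip 0 eps Vm.
  rewrite /cball /= subr0 enormE; apply: le_trans (nrmB _ _) _.
  by move: SS' td re; clear; lra.
have [Xp Xpe] := single _ Vpe; have [Xm Xme] := single _ Vme.
have XpM : tilt_argmin symip (objective A b C) Xs delta Vp Xp.
  by move: (erefl Xp : [set Xp] Xp); rewrite -Xpe.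
have XmM : tilt_argmin symip (objective A b C) Xs delta Vm Xm.
  by move: (erefl Xm : [set Xm] Xm); rewrite -Xme.
have lipd : nrm (Xp - Xm) <= L' * (2 * (tau * nrm d)).
  apply: le_trans (lip _ _ _ _ Vpe Vme XpM XmM) _.
  have -> : Vp - Vm = 2 *: (tau *: d).
    apply: symip_testP => Z; rewrite /Vp /Vm !(symipDl, symipNl, symipZl). ring.
  rewrite enormE !nrmZ (gtr0_norm tau0) gtr0_norm //.
  rewrite ler_wpM2r ?mulr_ge0 ?nrm_ge0 ?(ltW tau0) //.
  by apply: le_trans (ler_norm _) _; rewrite lerDl.
have [XpG _ Xpmin] := (tP _ _).1 XpM; have [XmG _ Xmmin] := (tP _ _).1 XmM.
have val U X : feasible A b X -> symip (C - (S' - S + U)) X =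
    - mxip y b - symip S' X - symip U X.
  move=> [_ AX]; have -> : C = - (adjoint A y + S) by rewrite yS opprK.
  by rewrite !(symipDl, symipNl) adjointP AX; ring.
have h1 := Xpmin _ X2G (le_trans X2r rd); rewrite !val // !symipZl in h1.
have h2 := Xmmin _ X1G (le_trans X1r rd); rewrite !val // !symipNl !symipZl in h2.
have gp := symip_psd_ge0 Sn XpG.1; have gm := symip_psd_ge0 Sn XmG.1.
have dd : symip d X2 - symip d X1 = nrm d ^+ 2 by rewrite -symipBr -/d sqr_nrm.
have dp : symip d Xp - symip d Xm <= nrm d * (L' * (2 * (tau * nrm d))).
  rewrite -symipBr; apply: le_trans (symip_le _ _) _.
  by rewrite ler_wpM2l ?nrm_ge0.
have dp2 : symip d Xp - symip d Xm <= 2^-1 * nrm d ^+ 2.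
  apply: le_trans dp _; have -> : nrm d * (L' * (2 * (tau * nrm d))) =
    tau * L' * 2 * nrm d ^+ 2 by ring.
  by rewrite tL (_ : 4^-1 * 2 = 2^-1 :> R) //; field.
have dp3 := ler_wpM2l (ltW tau0) dp2.
have dd2 := congr1 (fun x => tau * x) dd.
move: h1 h2 gp gm dp3 dd2; clear; lra.
Qed.

(** The two arcs have the directions [D] and [D + t W].  Because [W S = 0] and so
[W Pg = 0], the second-order matrix [B] and the tilt [Se e] are common to both. *)
Lemma tilt_stable_trivial_kernel y S W : psd Xs -> A Xs = b ->
  normal_cone symip psd Xs S -> adjoint A y + S = - C ->
  Sp (normal_cone symip psd Xs) `&` range (adjoint A) = [set 0] ->
  sdp_tilt_stable A b C Xs -> A W = 0 -> (W : 'M[R]_n) *m S = 0 -> W = 0.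
Proof.
move=> Xp AX SN yS nd stable AW WS.
have [c0 [r [c00 r0 gap]]] := tilt_stable_gap (conj Xp AX) yS stable.
have [XS SX] := normal_cone_mulmx0 Xp SN.
have [Sn _] := (normal_cone_psdP _ Xp).1 SN.
have Xsym := symM_tr Xs; have Ssym := symM_tr S.
have Xpm := (psdP _).1 Xp.
have [K [Ks XKC XKX KXK]] := pseudo_inverse_exists Xsym.
have [J [Js SJC SJS _]] := pseudo_inverse_exists Ssym.
pose Pg := (S : 'M[R]_n) *m J; pose P0 : 'M[R]_n := 1%:M - Xs *m K.
have Pgs : Pg^T = Pg by rewrite /Pg trmx_mul Ssym Js SJC.
have PgPg : Pg *m Pg = Pg by rewrite /Pg mulmxA SJS.
have XPg : Xs *m Pg = 0 by rewrite /Pg mulmxA XS mul0mx.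
have WPg : (W : 'M[R]_n) *m Pg = 0 by rewrite /Pg mulmxA WS mul0mx.
have SPg : (S : 'M[R]_n) *m Pg = S by rewrite /Pg SJC mulmxA SJS.
have PgS : Pg *m S = S by rewrite /Pg SJS.
have P0s : P0^T = P0 := kerproj_tr Xsym Ks XKC.
have P0P0 : P0 *m P0 = P0 := kerproj_idem XKX.
have XP0 : Xs *m P0 = 0 := mulmx_kerproj XKC XKX.
have P0Pg : P0 *m Pg = Pg := kerproj_sub XKC XPg.
have PgP0 : Pg *m P0 = Pg := sub_kerproj Xsym Ks XKC Pgs XPg.
have P0E : P0 = 1%:M - (Xs : 'M[R]_n) *m K by [].
clearbody P0 Pg.
have Pbsym : P0 - Pg \in symmx R n by rewrite symmxE linearB /= P0s Pgs.
have Pbi : (P0 - Pg) *m (P0 - Pg) = P0 - Pg.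
  by rewrite mulmxBl !mulmxBr P0P0 P0Pg PgP0 PgPg subrr subr0.
have P0Pb : P0 *m (P0 - Pg) = P0 - Pg by rewrite mulmxBr P0P0 P0Pg.
have [|D [AD PDP]] := nondegenerate_surjection (Z := SymM Pbsym) Xp nd P0s P0P0 XP0.
  by rewrite /= P0Pb mulmxBl P0P0 PgP0.
rewrite /= in PDP.
have DPg : P0 *m D *m Pg = 0.
  by rewrite -P0Pg mulmxA PDP mulmxBl P0Pg PgPg subrr.
apply/eqP; apply: contraT => W0.
have w0 : 0 < nrm W by exact: nrm_gt0.
pose t := (2 * (nrm W + 1))^-1.
have w1 : 0 < nrm W + 1 by rewrite ltr_wpDl ?nrm_ge0.
have t0 : 0 < t by rewrite invr_gt0 mulr_gt0.
have tw : t * nrm W <= 2^-1.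
  rewrite /t invfM -mulrA ler_piMr ?invr_ge0 // mulrC ler_pdivrMr // mul1r.
  by rewrite lerDl.
pose D' : symM R n := D + t *: W.
have D'Pg : (D' : 'M[R]_n) *m Pg = (D : 'M[R]_n) *m Pg.
  by rewrite /D' /= mulmxDl -scalemxAl WPg scaler0 addr0.
have PgD' : Pg *m D' = Pg *m D.
  by apply: trmx_inj; rewrite !trmx_mul Pgs !symM_tr.
pose trE := \tr (- (S : 'M[R]_n)).
have trE0 : 0 <= trE by exact: psdmx_tr_ge0 ((psdP _).1 Sn).
pose q : R := c0 * (t * nrm W) ^+ 2.
have q0 : 0 < q by rewrite mulr_gt0 // exprn_gt0 // mulr_gt0.
pose eta : R := q / (4 * (trE + 1)).
have trE1 : 0 < trE + 1 by rewrite ltr_wpDl.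
have eta0 : 0 < eta by rewrite divr_gt0 // mulr_gt0.
(* eta makes the gaps of order e^2 smaller than half of the distance term q e^2 *)
have etaE : 2 * (eta * trE) <= q / 2.
  have : eta * (4 * (trE + 1)) = q by rewrite /eta mulfVK // gt_eqF // mulr_gt0.
  by move: q0 eta0; lra.
pose Z : 'M[R]_n := Pg *m ((D : 'M[R]_n) *m K *m D) *m Pg + eta *: Pg.
have Zsym : Z \in symmx R n.
  rewrite symmxE /Z linearD linearZ /= !trmx_mul Pgs Ks symM_tr !mulmxA //.
have [|B [AB PBP]] := nondegenerate_surjection (Z := SymM Zsym) Xp nd P0s P0P0 XP0.
  rewrite /= /Z mulmxDr mulmxDl -scalemxAr -scalemxAl P0Pg PgP0.
  by rewrite !mulmxA P0Pg -!mulmxA PgP0.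
rewrite /= in PBP.
have PBP' : P0 *m B *m P0 = Pg *m ((D' : 'M[R]_n) *m K *m D') *m Pg + eta *: Pg.
  by rewrite PBP /Z !mulmxA PgD' -!mulmxA D'Pg.
have DPg' : P0 *m D' *m Pg = 0 by rewrite -mulmxA D'Pg mulmxA.
have Dsym := symM_tr D; have D'sym := symM_tr D'; have Bsym := symM_tr B.
have Dbb (u : 'cV[R]_n) : mxip ((P0 - Pg) *m u) ((D : 'M[R]_n) *m ((P0 - Pg) *m u)) =
    mxip ((P0 - Pg) *m u) ((P0 - Pg) *m u).
  rewrite -{1}P0Pb -mulmxA mxip_mull P0s -{2}P0Pb !mulmxA PDP.
  by rewrite Pbi.
pose L (e : R) : 'M[R]_n := 1%:M - e *: (K *m D).
pose Se e : symM R n := conj_symM (L e) S.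
have LD' e : (1%:M - e *: (K *m D')) *m (S : 'M[R]_n) = L e *m S.
  rewrite /L /D' /= mulmxDr -scalemxAr scalerDr !mulmxBl mulmxDl.
  by rewrite -!scalemxAl -(mulmxA K W) WS mulmx0 !scaler0 addr0.
have family (G : symM R n) : A G = 0 -> P0 *m G *m Pg = 0 ->
    P0 *m B *m P0 = Pg *m ((G : 'M[R]_n) *m K *m G) *m Pg + eta *: Pg ->
    (forall u : 'cV[R]_n, 2^-1 * mxip ((P0 - Pg) *m u) ((P0 - Pg) *m u) <=
       mxip ((P0 - Pg) *m u) ((G : 'M[R]_n) *m ((P0 - Pg) *m u))) ->
    (forall e, (1%:M - e *: (K *m G)) *m (S : 'M[R]_n) = L e *m S) ->
    exists e1 c : R, 0 < e1 /\ forall e : R, 0 < e -> e <= e1 -> e <= 1 ->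
      [/\ feasible A b (Xs + e *: G + e ^+ 2 *: B),
          nrm (Xs + e *: G + e ^+ 2 *: B - Xs) <= e * (nrm G + nrm B) &
          - symip (Se e) (Xs + e *: G + e ^+ 2 *: B) <=
            e ^+ 2 * (eta * trE) + e ^+ 3 * c].
  rewrite P0E => AG GPg BG Gbb GS.
  have [e1 e10 psd1] := perturbation_psd Xsym Xpm Ks XKC XKX KXK Pgs PgPg XPg
    (symM_tr G) Bsym GPg BG eta0 Gbb.
  have EPg : - (S : 'M[R]_n) *m Pg = - (S : 'M[R]_n) by rewrite mulNmx SPg.
  have PgE : Pg *m - (S : 'M[R]_n) = - (S : 'M[R]_n) by rewrite mulmxN PgS.
  have [c hc] := perturbation_gap Xsym Ks XKC KXK Pgs PgPg XPg (symM_tr G) GPg BG EPg PgE.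
  exists e1, c; split=> // e e_gt0 ee1 e_1; split.
  - split; first by apply/psdP; exact: psd1.
    by rewrite !linearD !linearZ /= AX AG AB !scaler0 !addr0.
  - have -> : Xs + e *: G + e ^+ 2 *: B - Xs = e *: G + e ^+ 2 *: B.
      by rewrite addrAC [Xs + _ - Xs]addrAC subrr add0r.
    apply: le_trans (nrmD _ _) _; rewrite !nrmZ gtr0_norm // gtr0_norm ?exprn_gt0 //.
    rewrite mulrDr lerD2l ler_wpM2r ?nrm_ge0 // expr2 ler_piMl // ltW //.
  apply: le_trans (hc e e_gt0 e_1); rewrite mulmxN mulNmx mxipNl lerN2.
  have -> : (1%:M - e *: (K *m G)) *m S *m (1%:M - e *: (K *m G))^T =
      L e *m S *m (L e)^T.
    rewrite GS -!mulmxA; congr (_ *m _).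
    by apply: trmx_inj; rewrite !trmx_mul !trmxK Ssym GS.
  by [].
have Dbb1 (u : 'cV[R]_n) : 2^-1 * mxip ((P0 - Pg) *m u) ((P0 - Pg) *m u) <=
    mxip ((P0 - Pg) *m u) ((D : 'M[R]_n) *m ((P0 - Pg) *m u)).
  rewrite Dbb; have := mxip_ge0 ((P0 - Pg) *m u); move: (mxip _ _) => x; lra.
have Dbb2 (u : 'cV[R]_n) : 2^-1 * mxip ((P0 - Pg) *m u) ((P0 - Pg) *m u) <=
    mxip ((P0 - Pg) *m u) ((D' : 'M[R]_n) *m ((P0 - Pg) *m u)).
  move: (Dbb u); move: ((P0 - Pg) *m u) => v Dv.
  rewrite /D' /= mulmxDl mxipDr Dv -scalemxAl mxipZr.
  have : - (nrm W * mxip v v) <= mxip v ((W : 'M[R]_n) *m v).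
    have := mxip_CS v ((W : 'M[R]_n) *m v); rewrite ler_norml => /andP[+ _].
    apply: le_trans; rewrite lerN2 -sqr_fro expr2 mulrCA ler_wpM2l ?fro_ge0 //.
    exact: fro_mulmx.
  move=> /(ler_wpM2l (ltW t0)); have := ler_wpM2r (mxip_ge0 v) tw.
  move: (mxip v v) (mxip v _) => x z; lra.
have [e1 [k1 [e10 fam1]]] := family D AD DPg PBP Dbb1 (fun=> erefl).
have AD' : A D' = 0 by rewrite linearD linearZ /= AD AW scaler0 addr0.
have [e2 [k2 [e20 fam2]]] := family D' AD' DPg' PBP' Dbb2 LD'.
pose cS := 2 * (fro (K *m D) * nrm S) + fro (K *m D) * nrm S * fro (K *m D).
have SeS e : 0 < e -> e <= 1 -> nrm (Se e - S) <= e * cS.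
  move=> e_gt0 e_1; have -> : nrm (Se e - S) =
      fro (e *: (- (K *m D *m S) - S *m (K *m D)^T + e *: (K *m D *m S *m (K *m D)^T))).
    rewrite /nrm /= /L; congr fro; move: (K *m D) => G.
    have -> : (1%:M - e *: G)^T = 1%:M - e *: G^T by rewrite linearB linearZ /= trmx1.
    rewrite !mulmxBl !mulmxBr !mulmx1 !mul1mx -!scalemxAl -!scalemxAr.
    move: (G *m S *m G^T) (S *m G^T) (G *m S) (S : 'M[R]_n) => x1 x2 x3 x4.
    by apply/matrixP => i j; rewrite !mxE; ring.
  rewrite froZ gtr0_norm // ler_pM2l //; apply: le_trans (froD _ _) _.
  have GS : fro (K *m D *m S) <= fro (K *m D) * nrm S by exact: fro_mulmx.
  have SG : fro (S *m (K *m D)^T) <= fro (K *m D) * nrm S.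
    by rewrite mulrC -(fro_tr (K *m D)); exact: fro_mulmx.
  apply: lerD.
    apply: le_trans (froD _ _) _; rewrite !froN mulr_natl mulr2n.
    exact: lerD GS SG.
  rewrite froZ gtr0_norm //; apply: le_trans (_ : fro (K *m D *m S *m (K *m D)^T) <= _).
    by rewrite ler_piMl ?fro_ge0.
  apply: le_trans (fro_mulmx _ _) _; rewrite fro_tr ler_wpM2r ?fro_ge0 //.
have cS0 : 0 <= cS.
  by rewrite addr_ge0 ?mulr_ge0 ?fro_ge0 ?nrm_ge0.
pose N := nrm D + nrm D' + nrm B + cS + t * nrm W + 1.
have [nD nD'] : 0 <= nrm D /\ 0 <= nrm D' by rewrite !nrm_ge0.
have nB : 0 <= nrm B := nrm_ge0 B.
have ntW : 0 < t * nrm W by rewrite mulr_gt0.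
have N1 : nrm D + nrm B <= N by move: nD nD' nB cS0 ntW; rewrite /N; clearbody cS; lra.
have N2 : nrm D' + nrm B <= N by move: nD nD' nB cS0 ntW; rewrite /N; clearbody cS; lra.
have N3 : cS <= N by move: nD nD' nB cS0 ntW; rewrite /N; clearbody cS; lra.
have N4 : t * nrm W <= N by move: nD nD' nB cS0 ntW; rewrite /N; clearbody cS; lra.
have N0 : 0 < N by apply: lt_le_trans N4.
pose k := `|k1| + `|k2| + 1.
have k0 : 0 < k by rewrite ltr_wpDl ?addr_ge0.
pose e := Num.min (Num.min e1 e2) (Num.min 1 (Num.min (r / N) (q / (4 * k)))).
have e_gt0 : 0 < e by rewrite !lt_min e10 e20 ltr01 !divr_gt0 ?mulr_gt0.
have [ee1 ee2] : e <= e1 /\ e <= e2 by rewrite /e !ge_min !lexx !orbT.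
have e_1 : e <= 1 by rewrite /e !ge_min !lexx !orbT.
have eN : e * N <= r by rewrite -ler_pdivlMr // /e !ge_min lexx !orbT.
have ek : e * (4 * k) <= q by rewrite -ler_pdivlMr ?mulr_gt0 // /e !ge_min lexx !orbT.
clearbody e N; have small x : x <= N -> e * x <= r.
  by move=> xN; apply: le_trans eN; rewrite ler_pM2l.
have [X1G X1n X1gap] := fam1 e e_gt0 ee1 e_1.
have [X2G X2n X2gap] := fam2 e e_gt0 ee2 e_1.
have Sen : psd (- Se e).
  apply/psdP; have := psdmx_conj (L e)^T ((psdP _).1 Sn).
  by rewrite trmxK /= mulmxN mulNmx.
have XX : Xs + e *: D' + e ^+ 2 *: B - (Xs + e *: D + e ^+ 2 *: B) = (e * t) *: W.
  by apply: symip_testP => V; rewrite /D' !(symipDl, symipNl, symipZl); ring.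
have XXn : nrm (Xs + e *: D' + e ^+ 2 *: B - (Xs + e *: D + e ^+ 2 *: B)) = e * (t * nrm W).
  by rewrite XX nrmZ gtr0_norm ?mulr_gt0 // mulrA.
have := gap _ _ _ Sen (le_trans (SeS e e_gt0 e_1) (small _ N3)) X1G X2G
  (le_trans X1n (small _ N1)) (le_trans X2n (small _ N2)).
rewrite XXn => /(_ (small _ N4)) final.
have : e ^+ 2 * q <= e ^+ 2 * (2 * (eta * trE) + e * k).
  have -> : e ^+ 2 * q = c0 * (e * (t * nrm W)) ^+ 2 by rewrite /q; ring.
  apply: le_trans final _; apply: le_trans (lerD X1gap X2gap) _.
  have -> : e ^+ 2 * (eta * trE) + e ^+ 3 * k1 + (e ^+ 2 * (eta * trE) + e ^+ 3 * k2) =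
    e ^+ 2 * (2 * (eta * trE) + e * (k1 + k2)) by ring.
  rewrite ler_pM2l ?exprn_gt0 // lerD2l ler_pM2l // /k.
  by apply: le_trans (lerD (ler_norm k1) (ler_norm k2)) _; rewrite lerDl.
rewrite ler_pM2l ?exprn_gt0 //; by move=> h5; exfalso; move: (q) (eta * trE) etaE ek q0 h5; clear; move=> *; lra.
Qed.

End Necessity.

(** * The characterization of tilt stability *)

Theorem proposition3p2 (R : realType) (n m : nat)
    (A : {linear symM R n -> 'cV[R]_m}) (b : 'cV[R]_m) (C Xs : symM R n)
    (Xs_opt : sdp_optimal A b C Xs)
    (G_reg : metrically_regular symip (prod_ip mxip symip)
               (constraint_map A b) Xs (0, 0))
    (ys : 'cV[R]_m) (Ss : symM R n)
    (ySs : multipliers A b Xs (- C) (ys, Ss)) :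
  (* (i) *)
  (((forall y S, multipliers A b Xs (- C) (y, S) ->
       (\rank (Ss : 'M[R]_n) <= \rank (S : 'M[R]_n))%N) ->
    linker A `&` orth symip (lspan1 C) `&` Upsilon Xs Ss = [set 0] ->
    sdp_tilt_stable A b C Xs) /\
   ((Sp (normal_cone symip psd Xs) `&` range (adjoint A) = [set 0] \/
     Sp (normal_cone symip psd Xs) `<=` range (adjoint A)) ->
    sdp_tilt_stable A b C Xs ->
    linker A `&` Upsilon_tilde Xs Ss = [set 0]))
  /\
  (* (ii) *)
  ((multipliers A b Xs (- C) =
      (adjoint A @^-1` [set - C - Ss]) `*` [set Ss] ->
    linker A `&` Upsilon_hat Xs Ss = [set 0] ->
    sdp_tilt_stable A b C Xs) /\
   ((Sp (normal_cone symip psd Xs) `&` range (adjoint A) = [set 0] \/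
     Sp (normal_cone symip psd Xs) `<=` range (adjoint A)) ->
    sdp_tilt_stable A b C Xs ->
    linker A `&` Upsilon_hat Xs Ss = [set 0])).
Proof.
have [XsG Xsmin] := Xs_opt; have [Xp AX] := XsG.
have [surj [eta [X0 sf]]] := slater_of_regularity G_reg AX.
have [_ /= SN yS] := ySs.
have sharp_tilt : (forall y S W, multipliers A b Xs (- C) (y, S) -> A W = 0 ->
    symip C W = 0 -> (W : 'M[R]_n) *m S = 0 -> W = 0) -> sdp_tilt_stable A b C Xs.
  move=> sharp.
  have [kappa [delta [k0 d0 gr]]] := growth_of_sharp_multipliers Xs_opt surj sf sharp.
  exact: tilt_stable_of_growth gr.
have tildeP := fun W => Upsilon_tildeP W Xp SN.
have tilde_necessary : (Sp (normal_cone symip psd Xs) `&` range (adjoint A) = [set 0] \/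
      Sp (normal_cone symip psd Xs) `<=` range (adjoint A)) ->
    sdp_tilt_stable A b C Xs -> linker A `&` Upsilon_tilde Xs Ss = [set 0].
  move=> cq stable; have nd : Sp (normal_cone symip psd Xs) `&` range (adjoint A) = [set 0].
    by case: cq => // sub; exact: normal_cone_trivial sf Xp AX sub.
  apply/seteqP; split=> [W [AW /tildeP WS]|W ->].
    exact: (tilt_stable_trivial_kernel Xp AX SN yS nd stable AW WS).
  by split; [rewrite /linker /= linear0|apply/tildeP; rewrite /= mul0mx].
split; split=> //.
- move=> rank_min trivial; apply: sharp_tilt => y S W [_ /= SN' yS'] AW CW WS.
  suff : [set 0] W by [].
  rewrite -trivial; split; [split=> //|].
    by move=> _ [t _ <-]; rewrite symipZl CW mulr0.
  apply: (Upsilon_of_rank Xp SN SN') => //; apply: (rank_min y).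
  by split=> // X' X'G; rewrite symipNl oppr_le0 symipBr subr_ge0 Xsmin.
- move=> unique trivial; apply: sharp_tilt => y S W yS' AW _ WS.
  have SE : S = Ss by move: yS'; rewrite unique => -[].
  suff : [set 0] W by [].
  by rewrite -trivial; split=> //; apply/tildeP; rewrite -SE.
Qed.
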